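(* Let $\xi\in K$, $\rho>0$ with $|(q-1)\xi|<\rho$, so that the open disk $D=D(\xi,\rho^-)=\{x\in K:|x-\xi|<\rho\}$ is $q$-invariant. Let $Y(x)\in Gl_\mu(\mathcal M_D)$ and, for every integer $n\ge 0$, let $G_n(x)=d_q^n(Y)(x)\,Y(x)^{-1}\in M_{\mu\times\mu}(\mathcal M_D)$. Then for every $n\ge0$ $$\left\|\frac{G_n(x)}{[n]_q^!}\right\|_{\xi,\rho}\le \{n,\mu-1\}_p^q\left(\sup_{i=0,\dots,\mu-1}\|G_i(x)\|_{\xi,\rho}\,\rho^i\right)\frac{1}{\rho^n},$$ where $\{0,\mu-1\}_p^q=1$ and, for $n\ge1$, $\{n,\mu-1\}_p^q=\sup_{1\le\lambda_1<\dots<\lambda_{\mu-1}\le n,\ \lambda_i\in\mathbb Z}\frac{1}{|[\lambda_1]_q\cdots[\lambda_{\mu-1}]_q|}$.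
   Context: $K$ is an algebraically closed field of characteristic $0$, complete for a non-archimedean absolute value $|\cdot|$ with $|p|=p^{-1}$. Fixed $q\in K$ satisfies $|q|=1$, $q$ is not a root of unity, and the reduction of $q$ in the residue field of $K$ is algebraic over $\mathbb F_p$. $[n]_q=1+q+\dots+q^{n-1}$ ($[0]_q=0$), $[n]_q^!=[1]_q\cdots[n]_q$, $[0]_q^!=1$. $d_q f(x)=\frac{f(qx)-f(x)}{(q-1)x}$. $\mathcal A_D$ is the ring of analytic functions $\sum_{n\ge0}a_n(x-\xi)^n$ on $D$ and $\mathcal M_D$ its fraction field. For $0<R<\rho$, the Gauss norm is $\|\sum f_n(x-\xi)^n\|_\xi(R)=\sup_n|f_n|R^n$, extended multiplicatively to $\mathcal M_D$, and $\|f\|_{\xi,\rho}=\lim_{R\to\rho}\|f\|_\xi(R)$ (possibly infinite). The norm of a matrix is the supremum of the norms of its entries.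
   Formalization: For 1≤n<μ-1 the sup defining {n,μ-1} is over an empty set; there one takes min(μ-1,n) integers λ_i, i.e. the value 1/|[n]_q^!|. The boundary norm is the limsup as R→ρ, since the limit may not exist on M_D; it equals the limit when that exists. μ≥1 is assumed. *)

(* Defs.v *)
From HB Require Import structures.
From mathcomp Require Import all_boot all_order all_algebra.
From mathcomp Require Import generic_quotient ring_quotient.
From mathcomp Require Import ring.
From mathcomp Require Import all_classical all_reals all_analysis.

Set Implicit Arguments.
Unset Strict Implicit.
Unset Printing Implicit Defensive.
Import Order.TTheory GRing.Theory Num.Theory.
Import numFieldNormedType.Exports.
Local Open Scope classical_set_scope.
Local Open Scope ring_scope.
Local Open Scope quotient_scope.

Record padicField (R : realType) (p : nat) := PadicField {
  padic_sort :> closedFieldType;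
  vabs : padic_sort -> R;
  padic_prime : prime p;
  padic_char0 : [pchar padic_sort] =i pred0;
  vabs_ge0 : forall x, 0 <= vabs x;
  vabs_eq0 : forall x, (vabs x == 0) = (x == 0);
  vabsM : {morph vabs : x y / x * y};
  vabs_ultra : forall x y, vabs (x + y) <= Num.max (vabs x) (vabs y);
  vabs_p : vabs p%:R = p%:R^-1;
  padic_complete : forall u : nat -> padic_sort,
    (forall e : R, 0 < e ->
       exists N, forall m n, (N <= m)%N -> (N <= n)%N -> vabs (u m - u n) < e) ->
    exists l, vabs (u n - l) @[n --> \oo] --> (0 : R)
}.

Section AbsoluteValue.
Variables (R : realType) (p : nat) (K : padicField R p).
Implicit Types (x y l : K) (u v : nat -> K).

Lemma vabs0 : vabs (0 : K) = 0.
Proof. by apply/eqP; rewrite vabs_eq0. Qed.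

Lemma vabs1 : vabs (1 : K) = 1.
Proof.
have n0 : vabs (1 : K) != 0 by rewrite vabs_eq0 oner_eq0.
by apply: (mulfI n0); rewrite -vabsM !mulr1.
Qed.

Lemma vabsX x n : vabs (x ^+ n) = vabs x ^+ n.
Proof.
by elim: n => [|n ih]; rewrite ?expr0 ?vabs1 // !exprS vabsM ih.
Qed.

Lemma vabsN x : vabs (- x) = vabs x.
Proof.
have h : vabs (-1 : K) = 1.
  have : vabs (-1 : K) ^+ 2 == 1 by rewrite -vabsX sqrrN expr1n vabs1.
  by rewrite sqrf_eq1 => /orP[/eqP //|/eqP h]; have := vabs_ge0 (-1 : K); rewrite h ler0N1.
by rewrite -mulN1r vabsM h mul1r.
Qed.

Lemma vabsBC x y : vabs (x - y) = vabs (y - x).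
Proof. by rewrite -vabsN opprB. Qed.

Lemma vabsV x : vabs x^-1 = (vabs x)^-1.
Proof.
have [->|x0] := eqVneq x 0; first by rewrite invr0 vabs0 invr0.
have n0 : vabs x != 0 by rewrite vabs_eq0.
by apply: (mulfI n0); rewrite -vabsM !mulfV ?vabs1.
Qed.

Lemma vabsD_le x y (B : R) : vabs x <= B -> vabs y <= B -> vabs (x + y) <= B.
Proof. by move=> hx hy; apply: le_trans (vabs_ultra _ _) _; rewrite ge_max hx hy. Qed.

Lemma vabsB_le x y (B : R) : vabs x <= B -> vabs y <= B -> vabs (x - y) <= B.
Proof. by move=> hx hy; apply: vabsD_le; rewrite ?vabsN. Qed.

Lemma vabsD_lt x y (B : R) : vabs x < B -> vabs y < B -> vabs (x + y) < B.
Proof. by move=> hx hy; apply: le_lt_trans (vabs_ultra _ _) _; rewrite gt_max hx hy. Qed.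

Lemma vabs_sum_le (I : Type) (r : seq I) (P : pred I) (F : I -> K) (B : R) :
  0 <= B -> (forall i, P i -> vabs (F i) <= B) -> vabs (\sum_(i <- r | P i) F i) <= B.
Proof.
move=> B0 h; apply: (big_ind (fun z => vabs z <= B)) => //; first by rewrite vabs0.
by move=> x y; apply: vabsD_le.
Qed.

Lemma vabs_nat n : vabs (n%:R : K) <= 1.
Proof. by elim: n => [|n ih]; rewrite ?vabs0 // -addn1 natrD vabsD_le // vabs1. Qed.

Definition vint : {pred K} := [pred x | vabs x <= 1].

Lemma vint_subring : subring_closed vint.
Proof.
split=> [|x y|x y]; rewrite !inE ?vabs1 //; first exact: vabsB_le.
by move=> hx hy; rewrite vabsM mulr_ile1 ?vabs_ge0.
Qed.
HB.instance Definition _ := GRing.isSubringClosed.Build K vint vint_subring.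

Record vring := VRing { vring_val :> K; vringP : vring_val \in vint }.
HB.instance Definition _ := [isSub for vring_val].
HB.instance Definition _ := [Choice of vring by <:].
HB.instance Definition _ := [SubChoice_isSubComNzRing of vring by <:].

Definition vmax : {pred vring} := [pred x | vabs (vring_val x) < 1].

Lemma vmax_ideal : idealr_closed vmax.
Proof.
split=> [||a x y]; rewrite !inE /= ?vabs0 // ?vabs1 ?ltxx // => hx hy.
apply: vabsD_lt => //; rewrite vabsM.
by apply: le_lt_trans hx; rewrite ler_piMl ?vabs_ge0 //; apply: vringP.
Qed.
HB.instance Definition _ := isIdealr.Build vring vmax vmax_ideal.

Definition residue := {ideal_quot vmax}.
HB.instance Definition _ := GRing.ComNzRing.on residue.

Definition vproj (x : vring) : residue := \pi_{ideal_quot vmax} x.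

Lemma vproj0 : vproj 0 = 0. Proof. exact: raddf0. Qed.
Lemma vproj1 : vproj 1 = 1. Proof. exact: rmorph1. Qed.
Lemma vprojM : {morph vproj : x y / x * y}. Proof. exact: rmorphM. Qed.
Lemma vproj_repr (a : residue) : vproj (repr (a : {ideal_quot vmax})) = a.
Proof. exact: reprK. Qed.
Lemma vproj_eq0 (x : vring) : (vproj x == 0) = (vabs (vring_val x) < 1).
Proof. by rewrite -vproj0 -[LHS]Quotient.idealrBE subr0. Qed.

(* Reduction modulo the maximal ideal; only meaningful when |x| <= 1. *)
Definition vred x : residue := vproj (insubd (0 : vring) x).

Definition residue_inv (a : residue) : residue :=
  vred (vring_val (repr (a : {ideal_quot vmax})))^-1.

Lemma residue_mulV (a : residue) : a != 0 -> residue_inv a * a = 1.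
Proof.
rewrite /residue_inv -{1 3}(vproj_repr a) vproj_eq0.
set x := repr _ => x1.
have xle : vabs (vring_val x) <= 1 by exact: vringP x.
have {}x1 : vabs (vring_val x) = 1 by apply/eqP; rewrite eq_le xle leNgt.
have xi : (vring_val x)^-1 \in vint by rewrite inE vabsV x1 invr1.
have vi : vring_val (insubd (0 : vring) (vring_val x)^-1) = (vring_val x)^-1.
  by rewrite -[LHS]/(val _) val_insubd xi.
rewrite /vred -vprojM -vproj1; congr vproj; apply: val_inj => /=.
by rewrite vi mulVf // -vabs_eq0 x1 oner_eq0.
Qed.

Lemma residue_inv0 : residue_inv 0 = 0.
Proof.
rewrite /residue_inv; set x := repr _.
have xlt : vabs (vring_val x) < 1 by rewrite -vproj_eq0 vproj_repr.
rewrite /vred -[RHS]vproj0; congr vproj; apply: val_inj; rewrite val_insubd.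
have [->|x0] := eqVneq (vring_val x) 0; first by rewrite invr0 inE vabs0 ler01.
case: ifPn => //; rewrite inE vabsV invf_cp1 ?leNgt ?xlt //.
by rewrite lt_neqAle vabs_ge0 andbT eq_sym vabs_eq0.
Qed.

HB.instance Definition _ :=
  GRing.ComNzRing_isField.Build residue residue_mulV residue_inv0.

(* The canonical embedding F_p -> residue: the residue field has characteristic p
   because |p| = 1/p < 1. *)
Definition Fp_residue (a : 'F_p) : residue := (a : nat)%:R.

End AbsoluteValue.

Section Convergence.
Variables (R : realType) (p : nat) (K : padicField R p).
Implicit Types (x y l : K) (u v a b : nat -> K).

Definition vcvg u l := vabs (u n - l) @[n --> \oo] --> (0 : R).

Lemma vcvgP u l : vcvg u l <->
  forall e : R, 0 < e -> exists N, forall n, (N <= n)%N -> vabs (u n - l) < e.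
Proof.
split=> [/cvgr0Pnorm_lt h e e0|h].
  have [N _ hN] := h _ e0; exists N => n Nn.
  by have := hN n Nn; rewrite /= ger0_norm ?vabs_ge0.
apply/cvgr0Pnorm_lt => e e0; have [N hN] := h _ e0; exists N => // n Nn.
by rewrite /= ger0_norm ?vabs_ge0 // hN.
Qed.

Lemma vcvg_unique u l l' : vcvg u l -> vcvg u l' -> l = l'.
Proof.
move=> /vcvgP h /vcvgP h'; apply/eqP; rewrite -subr_eq0 -vabs_eq0.
apply/negPn/negP => n0.
have e0 : 0 < vabs (l - l') by rewrite lt_neqAle eq_sym n0 vabs_ge0.
have [N hN] := h _ e0; have [N' hN'] := h' _ e0.
have := hN _ (leq_maxl N N'); have := hN' _ (leq_maxr N N').
set n := maxn N N' => h1 h2.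
rewrite vabsBC in h2; have := vabsD_lt h2 h1.
by rewrite addrA subrK ltxx.
Qed.

Lemma vcvgD u v l l' : vcvg u l -> vcvg v l' -> vcvg (fun n => u n + v n) (l + l').
Proof.
move=> /vcvgP h /vcvgP h'; apply/vcvgP => e e0.
have [N hN] := h _ e0; have [N' hN'] := h' _ e0.
exists (maxn N N') => n; rewrite geq_max => /andP[n1 n2].
by rewrite opprD addrACA vabsD_lt ?hN ?hN'.
Qed.

Lemma vcvgN u l : vcvg u l -> vcvg (fun n => - u n) (- l).
Proof.
move=> /vcvgP h; apply/vcvgP => e /h[N hN]; exists N => n /hN.
by rewrite -opprD vabsN.
Qed.

Lemma vcvg_bounded u l : vcvg u l -> exists2 M, 0 < M & forall n, vabs (u n) <= M.
Proof.
move=> /vcvgP/(_ _ ltr01)[N hN].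
have S0 : 0 <= \sum_(i < N) vabs (u i) by apply: sumr_ge0 => i _; apply: vabs_ge0.
exists (1 + vabs l + \sum_(i < N) vabs (u i)).
  by rewrite -addrA ltr_wpDr // addr_ge0 ?vabs_ge0.
move=> n; case: (ltnP n N) => nN.
  rewrite (bigD1 (Ordinal nN)) //= addrCA lerDl !addr_ge0 ?vabs_ge0 ?ler01 //.
  by apply: sumr_ge0 => i _; apply: vabs_ge0.
rewrite ler_wpDr // -[u n](subrK l); apply: vabsD_le.
  by apply: le_trans (ltW (hN _ nN)) _; rewrite lerDl vabs_ge0.
by rewrite lerDr ler01.
Qed.

Lemma vcvgM u v l l' : vcvg u l -> vcvg v l' -> vcvg (fun n => u n * v n) (l * l').
Proof.
move=> hu hv; have [M M0 hM] := vcvg_bounded hu.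
move: hu hv => /vcvgP h /vcvgP h'; apply/vcvgP => e e0.
have L0 : 0 < vabs l' + 1 by rewrite ltr_wpDl ?vabs_ge0.
have [N hN] := h _ (divr_gt0 e0 L0); have [N' hN'] := h' _ (divr_gt0 e0 M0).
exists (maxn N N') => n; rewrite geq_max => /andP[n1 n2].
have -> : u n * v n - l * l' = u n * (v n - l') + (u n - l) * l'.
  by rewrite mulrBr mulrBl addrA subrK.
apply: vabsD_lt; rewrite vabsM.
  apply: le_lt_trans (_ : M * vabs (v n - l') < e).
    by rewrite ler_wpM2r ?vabs_ge0.
  by rewrite mulrC -ltr_pdivlMr // hN'.
apply: le_lt_trans (_ : vabs (u n - l) * (vabs l' + 1) < e).
  by rewrite ler_wpM2l ?vabs_ge0 // lerDl ler01.
by rewrite -ltr_pdivlMr // hN.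
Qed.

Definition psum a y (N : nat) : K := \sum_(i < N) a i * y ^+ i.

Lemma psum_term a y l : vcvg (psum a y) l -> vcvg (fun n => a n * y ^+ n) 0.
Proof.
move=> /vcvgP h; apply/vcvgP => e /h[N hN]; exists N => n Nn.
have hn := hN _ Nn; rewrite vabsBC in hn.
have := vabsD_lt (hN n.+1 (leqW Nn)) hn; rewrite addrA subrK /psum big_ord_recr /=.
by rewrite addrAC subrr add0r subr0.
Qed.

Lemma vsum_tail_le (F : nat -> K) (m n : nat) (B : R) : 0 <= B -> (m <= n)%N ->
  (forall i, (m <= i)%N -> vabs (F i) <= B) ->
  vabs (\sum_(i < n) F i - \sum_(i < m) F i) <= B.
Proof.
move=> B0 mn h; rewrite -!(big_mkord xpredT F) (big_cat_nat (n := m)) //=.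
rewrite addrAC subrr add0r big_nat_cond; apply: vabs_sum_le => // i.
by rewrite andbT => /andP[/h].
Qed.

Lemma vsum_cvg (F : nat -> K) : vcvg F 0 ->
  exists l, vcvg (fun N => \sum_(i < N) F i) l.
Proof.
move=> /vcvgP h; apply: padic_complete => e e0.
have [N hN] := h _ (divr_gt0 e0 (ltr0Sn _ 1)); exists N => m n Nm Nn.
have hB i : (N <= i)%N -> vabs (F i) <= e / 2.
  by move=> /hN/ltW; rewrite subr0.
have e20 : 0 <= e / 2 by apply: ltW; apply: divr_gt0.
apply: (@le_lt_trans _ _ (e / 2)); last by rewrite ltr_pdivrMr // ltr_pMr // ltr1n.
rewrite -(subrK (\sum_(i < N) F i) (\sum_(i < m) F i)) -addrA.
apply: vabsD_le; first exact: vsum_tail_le.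
by rewrite vabsBC; apply: vsum_tail_le.
Qed.

Lemma vcvg_le u l (N : nat) (B : R) : 0 <= B -> vcvg u l ->
  (forall n, (N <= n)%N -> vabs (u n) <= B) -> vabs l <= B.
Proof.
move=> B0 /vcvgP h hB; rewrite leNgt; apply/negP => lB.
have e0 : 0 < vabs l by exact: le_lt_trans lB.
have [M hM] := h _ e0.
have := hM _ (leq_maxl M N); have := hB _ (leq_maxr M N).
set n := maxn M N => h1 h2.
rewrite vabsBC in h2; have := vabsD_lt h2 (le_lt_trans h1 lB).
by rewrite subrK ltxx.
Qed.

Lemma vabs_small (r : R) : 0 < r -> exists2 y : K, y != 0 & vabs y < r.
Proof.
move=> r0; have p1 : (1 < p)%N by apply/prime_gt1/(padic_prime K).
have [k hk] : exists k : nat, r^-1 < k%:R.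
  by exists (Num.bound r^-1); apply: archi_boundP; rewrite invr_ge0 ltW.
exists (p%:R ^+ k).
  by rewrite expf_eq0 negb_and -vabs_eq0 vabs_p invr_eq0 pnatr_eq0 -lt0n (ltnW p1) orbT.
rewrite vabsX vabs_p exprVn -(invrK r) ltf_pV2 ?posrE ?invr_gt0 ?exprn_gt0 ?ltr0n //.
  by apply: lt_trans hk _; rewrite -natrX ltr_nat ltn_expl.
exact: ltnW.
Qed.

Lemma psum_eq0 a (r : R) : 0 < r ->
  (forall y, vabs y < r -> vcvg (psum a y) 0) -> forall n, a n = 0.
Proof.
move=> r0 h n; elim/ltn_ind: n => m ih; apply/eqP/negPn/negP => am0.
have [y0 y00 y0r] := vabs_small r0.
have yp : 0 < vabs y0 by rewrite lt_neqAle eq_sym vabs_eq0 y00 vabs_ge0.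
have [M M0 hM] := vcvg_bounded (psum_term (h _ y0r)).
have cp : 0 < vabs (a m * y0 ^+ m).
  by rewrite lt_neqAle eq_sym vabs_eq0 mulf_neq0 ?expf_neq0 //= vabs_ge0.
have [t t0 tr] := vabs_small (divr_gt0 cp M0).
have [t1 | t1] := leP (vabs t) 1; last first.
  have : vabs (a m * y0 ^+ m) / M <= 1 by rewrite ler_pdivrMr // mul1r.
  by move=> /(lt_le_trans tr)/(lt_trans t1); rewrite ltxx.
have tp : 0 < vabs t by rewrite lt_neqAle eq_sym vabs_eq0 t0 vabs_ge0.
have yr : vabs (t * y0) < r.
  by apply: le_lt_trans y0r; rewrite vabsM ler_piMl ?vabs_ge0.
have B0 : 0 <= vabs t ^+ m.+1 * M by rewrite mulr_ge0 ?exprn_ge0 ?vabs_ge0 ?ltW.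
have : vabs (0 - a m * (t * y0) ^+ m) <= vabs t ^+ m.+1 * M.
  have hc : vcvg (fun n => psum a (t * y0) n - a m * (t * y0) ^+ m)
                 (0 - a m * (t * y0) ^+ m).
    apply: vcvgD; first exact: h.
    by apply/vcvgP => e e0; exists 0%N => k _; rewrite subrr vabs0.
  apply: (vcvg_le (N := m.+1) B0 hc) => k mk.
  have -> : a m * (t * y0) ^+ m = \sum_(i < m.+1) a i * (t * y0) ^+ i.
    by rewrite big_ord_recr /= big1 ?add0r // => i _; rewrite ih ?mul0r.
  apply: (@vsum_tail_le (fun i => a i * (t * y0) ^+ i)) => // i mi.
  rewrite exprMn mulrCA vabsM; apply: ler_pM; rewrite ?vabs_ge0 //.
  by rewrite vabsX ler_wiXn2l ?vabs_ge0.
rewrite sub0r vabsN exprMn mulrCA vabsM vabsX exprSr -mulrA ler_pM2l ?exprn_gt0 //.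
by rewrite -ler_pdivrMr // leNgt tr.
Qed.

Definition conv a b n : K := \sum_(i < n.+1) a i * b (n - i)%N.

Lemma psum_conv a b y l l' :
  vcvg (psum a y) l -> vcvg (psum b y) l' -> vcvg (psum (conv a b) y) (l * l').
Proof.
move=> hl hl'; rewrite -[_ * _]addr0.
have ha := psum_term hl; have hb := psum_term hl'.
have [M M0 hM] := vcvg_bounded ha; have [M' M0' hM'] := vcvg_bounded hb.
suff h : vcvg (fun n => psum (conv a b) y n - psum a y n * psum b y n) 0.
  have := vcvgD (vcvgM hl hl') h; congr vcvg; apply/funext => n.
  by rewrite addrC subrK.
apply/vcvgP => e e0.
move: ha hb => /vcvgP/(_ _ (divr_gt0 e0 M0'))[N hN].
move=> /vcvgP/(_ _ (divr_gt0 e0 M0))[N' hN'].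
exists (N + N')%N => n Nn; rewrite subr0.
pose P := \poly_(i < n) a i; pose Q := \poly_(i < n) b i.
have polyE c : psum c y n = (\poly_(i < n) c i).[y] by rewrite horner_poly.
have cE : psum (conv a b) y n = \sum_(i < n) (P * Q)`_i * y ^+ i.
  apply: eq_bigr => i _; congr (_ * _); rewrite coefM; apply: eq_bigr => j _.
  by rewrite !coef_poly (leq_ltn_trans _ (ltn_ord i)) ?(leq_ltn_trans _ (ltn_ord i)) ?leq_subr // -ltnS.
have PQE : psum a y n * psum b y n = \sum_(i < n + n) (P * Q)`_i * y ^+ i.
  rewrite !polyE -hornerM; apply: horner_coef_wide.
  apply: leq_trans (size_polyMleq _ _) _.
  by apply: leq_trans (leq_pred _) _; rewrite leq_add ?size_poly.
have [eh eh0 ehe] : exists2 eh, 0 < eh & eh < e.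
  by exists (e / 2); [apply: divr_gt0|rewrite ltr_pdivrMr // ltr_pMr // ltr1n].
rewrite cE PQE vabsBC.
have key i : (n <= i)%N -> vabs ((P * Q)`_i * y ^+ i) < e.
  move=> ni; rewrite coefM mulr_suml.
  apply: (big_ind (fun z => vabs z < e)); rewrite ?vabs0 //.
    by move=> *; apply: vabsD_lt.
  move=> j _; have ji : (j <= i)%N by rewrite -ltnS.
  have -> : y ^+ i = y ^+ j * y ^+ (i - j) by rewrite -exprD subnKC.
  rewrite mulrACA vabsM !coef_poly.
  have aB : vabs ((if (j < n)%N then a j else 0) * y ^+ j) <= vabs (a j * y ^+ j).
    by case: ifP => // _; rewrite mul0r vabs0 vabs_ge0.
  have bB : vabs ((if (i - j < n)%N then b (i - j)%N else 0) * y ^+ (i - j)) <=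
            vabs (b (i - j)%N * y ^+ (i - j)).
    by case: ifP => // _; rewrite mul0r vabs0 vabs_ge0.
  apply: le_lt_trans (ler_pM _ _ aB bB) _; rewrite ?vabs_ge0 //.
  have [Nj|jN] := leqP N j.
    apply: le_lt_trans (_ : vabs (a j * y ^+ j) * M' < e).
      by rewrite ler_wpM2l ?vabs_ge0.
    by rewrite -ltr_pdivlMr //; have := hN _ Nj; rewrite subr0.
  have Nij : (N' <= i - j)%N.
    rewrite leq_subRL //; apply: leq_trans (leq_trans Nn ni).
    by rewrite leq_add2r ltnW.
  apply: le_lt_trans (_ : M * vabs (b (i - j)%N * y ^+ (i - j)) < e).
    by rewrite ler_wpM2r ?vabs_ge0.
  by rewrite mulrC -ltr_pdivlMr //; have := hN' _ Nij; rewrite subr0.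
rewrite -!(big_mkord xpredT (fun i => (P * Q)`_i * y ^+ i)).
rewrite (big_cat_nat (n := n) (leq0n n) (leq_addr n n)) /= addrAC subrr add0r big_nat_cond.
apply: (big_ind (fun z => vabs z < e)); rewrite ?vabs0 //.
  by move=> *; apply: vabsD_lt.
by move=> i /andP[/andP[/key]].
Qed.

Lemma conv_eq0 a b : (forall n, conv a b n = 0) ->
  (forall n, a n = 0) \/ (forall n, b n = 0).
Proof.
move=> h; have [ha|/existsNP[m0 /eqP hm0]] := pselect (forall n, a n = 0); first by left.
have [hb|/existsNP[k0 /eqP hk0]] := pselect (forall n, b n = 0); first by right.
have exa : exists n, a n != 0 by exists m0.
have exb : exists n, b n != 0 by exists k0.
case: (ex_minnP exa) => m am minm; case: (ex_minnP exb) => k bk mink.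
have := h (m + k)%N; rewrite /conv.
have mlt : (m < (m + k).+1)%N by rewrite ltnS leq_addr.
rewrite (bigD1 (Ordinal mlt)) //= addKn big1 ?addr0.
  by move=> /eqP; rewrite mulf_eq0 (negPf am) (negPf bk).
move=> i; rewrite -val_eqE /= => im.
have [im'|mi] := ltnP i m.
  have -> : a i = 0 by apply/eqP/negPn/negP => /minm; rewrite leqNgt im'.
  by rewrite mul0r.
have -> : b (m + k - i)%N = 0; last by rewrite mulr0.
apply/eqP/negPn/negP => /mink; rewrite leqNgt.
have mi' : (m < i)%N by rewrite ltn_neqAle eq_sym im.
have imk : (i <= m + k)%N by rewrite -ltnS.
by rewrite (ltn_subLR _ imk) ltn_add2r mi'.
Qed.

Lemma psum_shift a (c h : K) (r : R) : 0 < r -> vabs c <= 1 -> vabs h < r ->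
  (forall y, vabs y < r -> exists l, vcvg (psum a y) l) ->
  exists b, forall y l, vabs y < r -> vcvg (psum a (c * y + h)) l ->
    vcvg (psum b y) l.
Proof.
move=> r0 c1 hr conva.
have term0 t : 0 <= t -> t = vabs h \/ (exists2 y : K, vabs y < r & t = vabs y) ->
    forall e, 0 < e -> exists N, forall n, (N <= n)%N -> vabs (a n) * t ^+ n < e.
  move=> t0 ht e e0.
  have [y yr ->] : exists2 y : K, vabs y < r & t = vabs y.
    by case: ht => // ->; exists h.
  have [l /psum_term/vcvgP/(_ e e0)[N hN]] := conva y yr.
  by exists N => n /hN; rewrite subr0 vabsM vabsX.
pose F k n : K := if (k <= n)%N then a n * 'C(n, k)%:R * h ^+ (n - k) else 0.
have FB k n t : vabs h <= t -> vabs (F k n) * t ^+ k <= vabs (a n) * t ^+ n.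
  move=> ht; have t0 : 0 <= t by exact: le_trans (vabs_ge0 _) ht.
  rewrite /F; case: leqP => kn; last by rewrite vabs0 mul0r mulr_ge0 ?vabs_ge0 ?exprn_ge0.
  have -> : t ^+ n = t ^+ (n - k) * t ^+ k by rewrite -exprD subnK.
  rewrite mulrA ler_wpM2r ?exprn_ge0 // !vabsM.
  apply: ler_pM; rewrite ?mulr_ge0 ?vabs_ge0 //.
    by rewrite ler_piMr ?vabs_ge0 ?vabs_nat.
  by rewrite vabsX lerXn2r ?nnegrE ?vabs_ge0.
have cvF k : exists l, vcvg (fun N => \sum_(n < N) F k n) l.
  apply: vsum_cvg; apply/vcvgP => e e0.
  have [y0 y00 y0r] := vabs_small r0.
  have yp : 0 < vabs y0 by rewrite lt_neqAle eq_sym vabs_eq0 y00 vabs_ge0.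
  pose t := Num.max (vabs h) (vabs y0).
  have tp : 0 < t by rewrite lt_max yp orbT.
  have ht : t = vabs h \/ exists2 y : K, vabs y < r & t = vabs y.
    by right; rewrite /t; case: leP => _; [exists y0|exists h].
  have [N hN] := term0 t (ltW tp) ht _ (mulr_gt0 e0 (exprn_gt0 k tp)).
  exists N => n /hN hn; rewrite subr0 -(ltr_pM2r (exprn_gt0 k tp)).
  by apply: le_lt_trans hn; apply: FB; rewrite le_max lexx.
pose s k := projT1 (cid (cvF k)).
have sP k : vcvg (fun N => \sum_(n < N) F k n) (s k) by rewrite /s; case: cid.
exists (fun k => c ^+ k * s k) => y l yr hl.
rewrite -[l]addr0.
suff hd : vcvg (fun N => psum (fun k => c ^+ k * s k) y N - psum a (c * y + h) N) 0.
  have := vcvgD hl hd; congr vcvg; apply/funext => N.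
  by rewrite addrC subrK.
apply/vcvgP => e e0.
pose t := Num.max (vabs h) (vabs y).
have t0 : 0 <= t by rewrite le_max vabs_ge0.
have ht : t = vabs h \/ exists2 y : K, vabs y < r & t = vabs y.
  by right; rewrite /t; case: leP => _; [exists y|exists h].
have [N hN] := term0 t t0 ht _ (divr_gt0 e0 (ltr0Sn _ 1)).
exists N => n Nn; rewrite subr0.
apply: (@le_lt_trans _ _ (e / 2)); last by rewrite ltr_pdivrMr // ltr_pMr // ltr1n.
have e20 : 0 <= e / 2 by apply: ltW; apply: divr_gt0.
have -> : psum a (c * y + h) n = \sum_(k < n) (c * y) ^+ k * \sum_(m < n) F k m.
  rewrite /psum.
  under [RHS]eq_bigr do rewrite mulr_sumr.
  rewrite exchange_big /=; apply: eq_bigr => m _.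
  rewrite addrC exprDn mulr_sumr (big_ord_widen_cond n predT (fun k => a m * (h ^+ (m - k) * (c * y) ^+ k *+ 'C(m, k)))) //=.
  rewrite big_mkcond; apply: eq_bigr => k _; rewrite /F ltnS.
  case: leqP => _; last by rewrite mulr0.
  by rewrite -mulr_natr; ring.
rewrite /psum -sumrB; apply: vabs_sum_le => // k _.
rewrite [c ^+ k * s k * _]mulrAC -exprMn -mulrBr vabsM vabsX vabsM.
apply: (@le_trans _ _ (vabs y ^+ k * vabs (s k - \sum_(m < n) F k m))).
  rewrite ler_wpM2r ?vabs_ge0 // lerXn2r ?nnegrE ?mulr_ge0 ?vabs_ge0 //.
  by rewrite ler_piMl ?vabs_ge0.
have [y0|y0] := eqVneq (vabs y ^+ k) 0; first by rewrite y0 mul0r.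
have yp : 0 < vabs y ^+ k by rewrite lt_neqAle eq_sym y0 exprn_ge0 ?vabs_ge0.
rewrite mulrC -ler_pdivlMr //.
have B0 : 0 <= e / 2 / vabs y ^+ k by apply: divr_ge0 => //; apply: ltW.
have hc : vcvg (fun M => \sum_(m < M) F k m - \sum_(m < n) F k m)
               (s k - \sum_(m < n) F k m).
  apply: vcvgD; first exact: sP.
  by apply/vcvgP => e' e'0; exists 0%N => i _; rewrite subrr vabs0.
apply: (vcvg_le (N := n) B0 hc) => M nM.
apply: vsum_tail_le => // i ni; rewrite ler_pdivlMr //.
apply: le_trans (ltW (hN i (leq_trans Nn ni))).
apply: le_trans (FB k i t _); last by rewrite le_max lexx.
rewrite ler_wpM2l ?vabs_ge0 // lerXn2r ?nnegrE ?vabs_ge0 //.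
by rewrite le_max lexx orbT.
Qed.

End Convergence.

Lemma lte_between (R : realType) (x y : \bar R) : (x < y)%E ->
  exists2 b : \bar R, (x < b)%E & (b < y)%E.
Proof.
case: x y => [x| |] [y| |] //= xy.
- rewrite lte_fin in xy; have [h1 h2] := midf_lt xy.
  by exists ((x + y) / 2)%:E; rewrite lte_fin.
- by exists (x + 1)%:E; rewrite ?ltry // lte_fin ltrDl.
- by exists (y - 1)%:E; rewrite ?ltNyr // lte_fin ltrBlDr ltrDl.
- by exists 0%E; rewrite ?ltNyr ?ltry.
Qed.

Lemma limf_esup_cvg (R : realType) (F : set_system R)
    (FF : ProperFilter F) (f : R -> \bar R) (l : \bar R) :
  f @ F --> l -> limf_esup f F = l.
Proof.
move=> fl; rewrite limf_esupE; apply/eqP; rewrite eq_le; apply/andP; split.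
  rewrite leNgt; apply/negP => hlt.
  have [b lb bs] : exists2 b : \bar R, (l < b)%E &
      (b < ereal_inf [set ereal_sup (f @` V) | V in F])%E.
    exact: lte_between.
  have FV : F [set x | (f x < b)%E] by apply: (fl [set y | (y < b)%E]); apply: open_nbhs_nbhs; split=> //; exact: open_ereal_lt_ereal.
  have : (ereal_inf [set ereal_sup (f @` V) | V in F] <= b)%E.
    apply: le_trans (_ : ereal_sup (f @` [set x | (f x < b)%E]) <= b)%E.
      by apply: ge_ereal_inf; exists (ereal_sup (f @` [set x | (f x < b)%E])) => //; exists [set x | (f x < b)%E].
    by apply: ge_ereal_sup => _ [x /= /ltW + <-].
  by rewrite leNgt bs.
apply: le_ereal_inf_tmp => _ [V FV <-].
apply: (cvge_to_le fl); apply: filterS FV => x Vx.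
by apply: ereal_sup_ubound; exists x.
Qed.

Lemma frac_repr (A : idomainType) (f : {fraction A}) :
  f * tofrac (frac (repr f)).2 = tofrac (frac (repr f)).1.
Proof.
set x := repr f; have d0 := denom_ratioP x.
rewrite -[f]reprK -/x; unlock FracField.tofrac; rewrite -[LHS]FracField.pi_mul.
apply/eqmodP => /=; rewrite /FracField.equivf /= /FracField.mulf.
by rewrite !numden_Ratio ?oner_neq0 ?mulr1 // mulrC.
Qed.

Section AnalyticFunctions.
Variables (R : realType) (p : nat) (K : padicField R p).
Variables (xi : K) (rho : {posnum R}).

Definition disk := {x : K | vabs (x - xi) < rho%:num}.

Definition mkdisk (x : K) (h : vabs (x - xi) < rho%:num) : disk := exist _ x h.

Lemma center_subproof : vabs (xi - xi) < rho%:num.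
Proof. by rewrite subrr vabs0. Qed.
Definition center : disk := exist _ xi center_subproof.

Definition expansion (f : disk -> K) (a : nat -> K) :=
  forall x : disk, vcvg (psum a (val x - xi)) (f x).

Lemma expansionP f a : expansion f a ->
  forall y, vabs y < rho%:num -> exists l, vcvg (psum a y) l.
Proof.
move=> h y yr; have yd : vabs (y + xi - xi) < rho%:num by rewrite addrK.
by exists (f (mkdisk yd)); have := h (mkdisk yd); rewrite /= addrK.
Qed.

Lemma expansion_eq0 a : expansion 0 a -> forall n, a n = 0.
Proof.
move=> h; apply: (@psum_eq0 _ _ _ _ rho%:num) => // y yr.
have yd : vabs (y + xi - xi) < rho%:num by rewrite addrK.
by have := h (mkdisk yd); rewrite /= addrK.
Qed.

Lemma expansion0 f : expansion f (fun=> 0) -> f = 0.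
Proof.
move=> h; apply/funext => x; apply: vcvg_unique (h x) _.
apply/vcvgP => e e0; exists 0%N => n _.
by rewrite /psum big1 ?subrr ?vabs0 // => i _; rewrite mul0r.
Qed.

Lemma expansionB f g a b : expansion f a -> expansion g b ->
  expansion (f - g) (fun n => a n - b n).
Proof.
move=> ha hb x; have := vcvgD (ha x) (vcvgN (hb x)); congr vcvg.
apply/funext => N; rewrite /psum -sumrB; apply: eq_bigr => i _.
by rewrite mulrBl.
Qed.

Lemma expansionM f g a b : expansion f a -> expansion g b ->
  expansion (f * g) (conv a b).
Proof. by move=> ha hb x; exact: psum_conv (ha x) (hb x). Qed.

Lemma expansion_cst (c : K) : expansion (cst c) (fun n => if n == 0%N then c else 0).
Proof.
move=> x; apply/vcvgP => e e0; exists 1%N => -[//|n] _.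
rewrite /psum big_ord_recl /= expr0 mulr1 big1 ?addr0 ?subrr ?vabs0 //.
by move=> i _; rewrite mul0r.
Qed.

Lemma expansion_id :
  expansion val (fun n => if n == 0%N then xi else if n == 1%N then 1 else 0).
Proof.
move=> x; apply/vcvgP => e e0; exists 2%N => -[//|[//|n]] _.
rewrite /psum 2!big_ord_recl /= expr0 mulr1 expr1 mul1r big1.
  by rewrite addr0 subrKC subrr vabs0.
by move=> i _; rewrite mul0r.
Qed.

(* Elements of A_D are functions on the disk with a power series expansion at xi
   converging on the whole disk; the ring operations are the pointwise ones. *)
Definition analytic : {pred disk -> K} := fun f => `[< exists a, expansion f a >].

Lemma analytic_cst c : (cst c : disk -> K) \in analytic.
Proof. by apply/asboolP; eexists; exact: expansion_cst. Qed.

Lemma analytic_id : (val : disk -> K) \in analytic.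
Proof. by apply/asboolP; eexists; exact: expansion_id. Qed.

Lemma analytic_subring : subring_closed analytic.
Proof.
split=> [|f g|f g]; first exact: analytic_cst.
  move=> /asboolP[a ha] /asboolP[b hb]; apply/asboolP.
  by eexists; exact: expansionB ha hb.
move=> /asboolP[a ha] /asboolP[b hb]; apply/asboolP.
by eexists; exact: expansionM ha hb.
Qed.
HB.instance Definition _ :=
  GRing.isSubringClosed.Build (disk -> K) analytic analytic_subring.

Record anfun := AnFun { anfun_val :> disk -> K; anfunP : anfun_val \in analytic }.
HB.instance Definition _ := [isSub for anfun_val].
HB.instance Definition _ := [Choice of anfun by <:].
HB.instance Definition _ :=
  GRing.SubChoice_isSubComPzRing.Build (disk -> K) analytic anfun (subringClosedP _).

Lemma anfun_oner_neq0 : (1 : anfun) != 0.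
Proof.
apply/eqP => /(congr1 (fun f : anfun => f center)) /eqP.
by rewrite (oner_eq0 K).
Qed.
HB.instance Definition _ := GRing.PzSemiRing_isNonZero.Build anfun anfun_oner_neq0.

Lemma coefs_subproof (f : anfun) : exists a, expansion f a.
Proof. by apply/asboolP; exact: anfunP. Qed.
Definition coefs (f : anfun) : nat -> K := projT1 (cid (coefs_subproof f)).

Lemma coefsP (f : anfun) : expansion f (coefs f).
Proof. by rewrite /coefs; case: cid. Qed.

Lemma coefs_unique (f : anfun) a : expansion f a -> coefs f = a.
Proof.
move=> h; apply/funext => n; apply/eqP; rewrite -subr_eq0; apply/eqP.
have := expansionB (coefsP f) h; rewrite subrr => /expansion_eq0/(_ n).
by [].
Qed.

Lemma anfun_mulf_eq0 (f g : anfun) : f * g = 0 -> (f == 0) || (g == 0).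
Proof.
move=> fg0; have := expansionM (coefsP f) (coefsP g).
have -> : (f : disk -> K) * g = 0 by rewrite -[LHS]/(val (f * g)) fg0.
have z (h : anfun) : (forall n, coefs h n = 0) -> h == 0.
  move=> h0; apply/eqP/val_inj/expansion0.
  by rewrite (_ : (fun=> 0) = coefs h); [exact: coefsP|apply/funext => n; rewrite h0].
by move=> /expansion_eq0/conv_eq0[] /z -> //; rewrite orbT.
Qed.

Definition anfun_unit : {pred anfun} := fun f => `[< exists g, g * f = 1 >].

Definition anfun_inv (f : anfun) : anfun :=
  if pselect (exists g, g * f = 1) is left h then projT1 (cid h) else f.

Lemma anfun_mulV : {in anfun_unit, left_inverse 1 anfun_inv *%R}.
Proof. by move=> f /asboolP h; rewrite /anfun_inv; case: pselect => // h'; case: cid. Qed.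

Lemma anfun_unitP (f g : anfun) : g * f = 1 -> anfun_unit f.
Proof. by move=> h; apply/asboolP; exists g. Qed.

Lemma anfun_inv_out : {in [predC anfun_unit], anfun_inv =1 id}.
Proof. by move=> f /asboolPn h; rewrite /anfun_inv; case: pselect. Qed.

HB.instance Definition _ := GRing.ComNzRing_hasMulInverse.Build anfun
  anfun_mulV anfun_unitP anfun_inv_out.
HB.instance Definition _ := GRing.ComUnitRing_isIntegral.Build anfun anfun_mulf_eq0.

Local Notation merofun := {fraction anfun}.

(* A chosen representation f = numer f / denom f; see gaussF_frac and qshiftF_frac
   for the independence of the choice. *)
Definition numer (f : merofun) : anfun := (frac (repr f)).1.
Definition denom (f : merofun) : anfun := (frac (repr f)).2.

Lemma denom_neq0 f : denom f != 0.
Proof. exact: denom_ratioP. Qed.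

Lemma numdenE f : f = tofrac (numer f) / tofrac (denom f).
Proof.
have d0 : tofrac (denom f) != 0 by rewrite tofrac_eq0 denom_neq0.
by apply: (mulIf d0); rewrite mulfVK // frac_repr.
Qed.

Lemma numden_cross u v : v != 0 ->
  numer (tofrac u / tofrac v) * v = u * denom (tofrac u / tofrac v).
Proof.
move=> v0; set f := tofrac u / tofrac v; apply/eqP.
rewrite -tofrac_eq !tofracM -frac_repr -/(denom f) {1}/f.
by rewrite mulrAC mulfVK // tofrac_eq0.
Qed.

Definition ancst (c : K) : anfun := AnFun (analytic_cst c).
Definition anX : anfun := AnFun analytic_id.

Definition gauss (f : anfun) (r : R) : R := sup (range (fun n => vabs (coefs f n) * r ^+ n)).

Lemma vabsD_eq (x y : K) : vabs y < vabs x -> vabs (x + y) = vabs x.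
Proof.
move=> yx; apply/eqP; rewrite eq_le; apply/andP; split; first by apply: vabsD_le => //; exact: ltW.
rewrite leNgt; apply/negP => h; rewrite -vabsN in yx; have := vabsD_lt h yx.
by rewrite addrK ltxx.
Qed.

Lemma vabs_between (r : R) : 0 < r -> r < rho%:num ->
  exists2 y : K, r <= vabs y & vabs y < rho%:num.
Proof.
move=> r0 rrho; have P0 : 0 < rho%:num by [].
set P := rho%:num in rrho P0 *.
have p1 : (1 < p)%N := prime_gt1 (padic_prime K).
have pR0 : 0 < p%:R^-1 :> R by rewrite invr_gt0 ltr0n ltnW.
have pR1 : p%:R^-1 < 1 :> R by rewrite invf_lt1 ?ltr1n ?ltr0n // ltnW.
have small (x e : R) : 0 <= x -> x < 1 -> 0 < e -> exists k, x ^+ k < e.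
  move=> x0 x1 e0; have xn : `|x| < 1 by rewrite ger0_norm.
  have /cvgr0Pnorm_lt/(_ _ e0)[N _ hN] := cvg_expr xn.
  by exists N; have := hN N (leqnn N); rewrite /= ger0_norm ?exprn_ge0.
have [k hk] : exists k, (r / P) ^+ k < p%:R^-1.
  by apply: small; rewrite ?divr_ge0 ?ltW // ltr_pdivrMr // mul1r.
have k0 : (0 < k)%N.
  by case: k hk => // hk; have := lt_trans hk pR1; rewrite expr0 ltxx.
have /closed_rootP[z] : size ('X^k - (p%:R : K)%:P) != 1%N.
  by rewrite size_XnsubC // eqSS -lt0n.
rewrite rootE !hornerE subr_eq0 => /eqP zk.
have tk : vabs z ^+ k = p%:R^-1 by rewrite -vabsX zk vabs_p.
have t0 : 0 < vabs z.
  rewrite lt_neqAle vabs_ge0 andbT eq_sym; apply/eqP => z0.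
  by move: pR0; rewrite -tk z0 expr0n eqn0Ngt k0 ltxx.
have t1 : vabs z < 1.
  by rewrite -(@expr_lt1 _ k) ?vabs_ge0 // tk.
have tr : r / P < vabs z.
  by rewrite -(@ltr_pXn2r _ k) ?nnegrE ?divr_ge0 ?vabs_ge0 ?ltW // tk.
have iP0 : 0 < P^-1 by rewrite invr_gt0.
have [w w0 wP] := @vabs_small _ _ K _ iP0.
have wp : 0 < vabs w by rewrite lt_neqAle eq_sym vabs_eq0 w0 vabs_ge0.
have exi : exists i, vabs (w^-1 * z ^+ i) < P.
  have [i hi] := small (vabs z) (P * vabs w) (ltW t0) t1 (mulr_gt0 P0 wp).
  by exists i; rewrite vabsM vabsX vabsV mulrC ltr_pdivrMr.
case: (ex_minnP exi) => -[|i] hi mini.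
  move: hi; rewrite expr0 mulr1 vabsV -(invrK P) ltf_pV2 ?posrE //.
  by move=> /(lt_trans wP); rewrite ltxx.
exists (w^-1 * z ^+ i.+1) => //.
have hPi : P <= vabs (w^-1 * z ^+ i).
  by rewrite leNgt; apply/negP => /mini; rewrite ltnn.
rewrite exprSr mulrA vabsM; apply: ltW; apply: (@lt_le_trans _ _ (P * vabs z)).
  by rewrite mulrC -ltr_pdivrMr.
by rewrite ler_wpM2r ?vabs_ge0.
Qed.

Lemma coefs_lim (f : anfun) (r : R) : 0 < r -> r < rho%:num ->
  forall e, 0 < e -> exists N, forall n, (N <= n)%N -> vabs (coefs f n) * r ^+ n < e.
Proof.
move=> r0 rrho e e0; have [y ry yrho] := vabs_between r0 rrho.
have [l /psum_term/vcvgP/(_ e e0)[N hN]] := expansionP (coefsP f) yrho.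
exists N => n /hN; rewrite subr0 vabsM vabsX; apply: le_lt_trans.
by rewrite ler_wpM2l ?vabs_ge0 // lerXn2r ?nnegrE ?vabs_ge0 // ltW.
Qed.

Lemma argmax_seq (s : nat -> R) m0 : (forall n, 0 <= s n) -> 0 < s m0 ->
  (forall e, 0 < e -> exists N, forall n, (N <= n)%N -> s n < e) ->
  exists m, (forall i, s i <= s m) /\ (forall i, (i < m)%N -> s i < s m).
Proof.
move=> s0 sm0 h; have [N hN] := h _ sm0.
have m0N : (m0 < N)%N by rewrite ltnNge; apply/negP => /hN; rewrite ltxx.
case: (@arg_maxP _ _ _ (Ordinal m0N) xpredT (fun i : 'I_N => s i) isT) => j _ hj.
have smax i : s i <= s j.
  case: (ltnP i N) => [iN|/hN/ltW/le_trans]; first exact: (hj (Ordinal iN)).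
  by apply; exact: (hj (Ordinal m0N)).
have ex : exists i, s i == s j by exists j.
case: (ex_minnP ex) => m /eqP mj minm; exists m; rewrite mj; split=> // i im.
rewrite lt_neqAle smax andbT; apply/negP => /minm.
by rewrite leqNgt im.
Qed.

Lemma coefs_neq0 (f : anfun) : f != 0 -> exists n, coefs f n != 0.
Proof.
move=> f0; apply/not_existsP => h; move/eqP: f0; apply; apply/val_inj/expansion0.
rewrite (_ : (fun=> 0) = coefs f); first exact: coefsP.
by apply/funext => n; apply/esym/eqP/negPn/negP/h.
Qed.

Lemma gauss_max (f : anfun) (r : R) : 0 < r -> r < rho%:num -> f != 0 ->
  exists m, [/\ gauss f r = vabs (coefs f m) * r ^+ m, 0 < gauss f r,
    forall i, vabs (coefs f i) * r ^+ i <= gauss f r &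
    forall i, (i < m)%N -> vabs (coefs f i) * r ^+ i < gauss f r].
Proof.
move=> r0 rrho /coefs_neq0[n0 fn0]; pose s n := vabs (coefs f n) * r ^+ n.
have s0 n : 0 <= s n by rewrite mulr_ge0 ?vabs_ge0 ?exprn_ge0 ?ltW.
have sn0 : 0 < s n0.
  by rewrite mulr_gt0 ?exprn_gt0 // lt_neqAle eq_sym vabs_eq0 fn0 vabs_ge0.
have [m [hm hm']] := argmax_seq s0 sn0 (coefs_lim f r0 rrho).
have ubs : ubound (range s) (s m) by move=> _ [i _ <-].
have hs : has_sup (range s) by split; [exists (s m), m|exists (s m)].
have gE : gauss f r = s m.
  apply/eqP; rewrite eq_le; apply/andP; split; first by apply: ge_sup => //; exists (s m), m.
  by apply: sup_upper_bound => //; exists m.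
by exists m; rewrite gE; split=> //; exact: lt_le_trans sn0 (hm _).
Qed.

Lemma gauss0 (r : R) : gauss 0 r = 0.
Proof.
have c0 : coefs 0 = fun=> 0.
  by apply/funext; apply: expansion_eq0; exact: (coefsP 0).
rewrite -[RHS]sup1; congr sup; apply/seteqP; split=> [_ [n _ <-]|_ ->] /=.
  by rewrite c0 vabs0 mul0r.
by exists 0%N; rewrite ?c0 ?vabs0 ?mul0r.
Qed.

Lemma gaussM (f g : anfun) (r : R) : 0 < r -> r < rho%:num ->
  gauss (f * g) r = gauss f r * gauss g r.
Proof.
move=> r0 rrho; have [->|f0] := eqVneq f 0; first by rewrite mul0r gauss0 mul0r.
have [->|g0] := eqVneq g 0; first by rewrite mulr0 gauss0 mulr0.
have [m [mE fp fle flt]] := gauss_max r0 rrho f0.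
have [k [kE gp gle glt]] := gauss_max r0 rrho g0.
have cE n : coefs (f * g) n = conv (coefs f) (coefs g) n.
  by rewrite (coefs_unique (f := f * g) (expansionM (coefsP f) (coefsP g))).
have fg0 : f * g != 0 by rewrite mulf_neq0.
have [n [nE _ hle _]] := gauss_max r0 rrho fg0.
have termE i j : vabs (coefs f i * coefs g j) * r ^+ (i + j) =
    (vabs (coefs f i) * r ^+ i) * (vabs (coefs g j) * r ^+ j).
  by rewrite vabsM exprD mulrACA.
apply/eqP; rewrite eq_le; apply/andP; split.
  rewrite nE cE -ler_pdivlMr ?exprn_gt0 //; apply: vabs_sum_le.
    by rewrite divr_ge0 ?mulr_ge0 ?exprn_ge0 ?ltW.
  move=> i _; rewrite ler_pdivlMr ?exprn_gt0 //.
  have -> : r ^+ n = r ^+ (i + (n - i)) by rewrite subnKC // -ltnS.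
  rewrite termE; apply: ler_pM => //; rewrite mulr_ge0 ?vabs_ge0 ?exprn_ge0 ?ltW //.
apply: le_trans (hle (m + k)%N); rewrite cE /conv.
have mlt : (m < (m + k).+1)%N by rewrite ltnS leq_addr.
rewrite (bigD1 (Ordinal mlt)) //= addKn vabsD_eq; first by rewrite termE -mE -kE.
have Bp : 0 < vabs (coefs f m * coefs g k).
  by rewrite -(pmulr_lgt0 _ (exprn_gt0 (m + k) r0)) termE -mE -kE mulr_gt0.
apply: (big_ind (fun z => vabs z < vabs (coefs f m * coefs g k))); rewrite ?vabs0 //.
  by move=> *; apply: vabsD_lt.
move=> i; rewrite -val_eqE /= => im.
have imk : (i <= m + k)%N by rewrite -ltnS.
rewrite -(ltr_pM2r (exprn_gt0 (m + k) r0)) [ltRHS]termE -mE -kE.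
have -> : r ^+ (m + k) = r ^+ (i + (m + k - i)) by rewrite subnKC.
rewrite termE; have [im'|mi] := ltnP i m.
  apply: le_lt_trans (_ : (vabs (coefs f i) * r ^+ i) * gauss g r < _).
    by apply: ler_wpM2l => //; rewrite mulr_ge0 ?vabs_ge0 ?exprn_ge0 // ltW.
  by rewrite ltr_pM2r // flt.
have mi' : (m < i)%N by rewrite ltn_neqAle eq_sym im.
apply: le_lt_trans (_ : gauss f r * (vabs (coefs g (m + k - i)%N) * r ^+ (m + k - i)) < _).
  by apply: ler_wpM2r => //; rewrite mulr_ge0 ?vabs_ge0 ?exprn_ge0 // ltW.
by rewrite ltr_pM2l // glt // (ltn_subLR _ imk) ltn_add2r.
Qed.

Lemma gauss_neq0 (f : anfun) (r : R) : 0 < r -> r < rho%:num -> f != 0 -> gauss f r != 0.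
Proof. by move=> r0 rrho f0; have [m [_ /gt_eqF/negbT]] := gauss_max r0 rrho f0. Qed.

Definition gaussF (f : merofun) (r : R) : R :=
  gauss (numer f) r / gauss (denom f) r.

Lemma gaussF_frac (u v : anfun) (r : R) : 0 < r -> r < rho%:num -> v != 0 ->
  gaussF (tofrac u / tofrac v) r = gauss u r / gauss v r.
Proof.
move=> r0 rrho v0; rewrite /gaussF; apply/eqP.
rewrite eqr_div ?gauss_neq0 ?denom_neq0 //.
by rewrite -!gaussM // numden_cross.
Qed.

(* The limit of gaussF f r as r tends to rho from below, possibly infinite.  For a
   quotient of two analytic functions with infinitely many zeros this limit may fail
   to exist; the limit superior is total and is the limit whenever the latter exists
   (bnormE). *)
Definition bnorm (f : merofun) : \bar R :=
  limf_esup (fun r => (gaussF f r)%:E) (rho%:num^'-).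

Lemma bnormE f l : (gaussF f r)%:E @[r --> rho%:num^'-] --> l -> bnorm f = l.
Proof. exact: limf_esup_cvg. Qed.

Definition mxbnorm m n (A : 'M[merofun]_(m, n)) : \bar R :=
  \big[maxe/-oo%E]_(i < m) \big[maxe/-oo%E]_(j < n) bnorm (A i j).

Section QDifference.
Variables (q : K) (q1 : vabs q = 1) (qxi : vabs ((q - 1) * xi) < rho%:num).

Lemma qdisk_subproof (x : disk) : vabs (q * val x - xi) < rho%:num.
Proof.
have -> : q * val x - xi = q * (val x - xi) + (q - 1) * xi.
  by rewrite mulrBr mulrBl mul1r addrA subrK.
by apply: vabsD_lt => //; rewrite vabsM q1 mul1r; exact: (svalP x).
Qed.
Definition qdisk (x : disk) : disk := exist _ (q * val x) (qdisk_subproof x).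

Lemma qshift_subproof (f : anfun) : (f \o qdisk) \in analytic.
Proof.
have r0 : 0 < rho%:num by []; have q1' : vabs q <= 1 by rewrite q1.
apply/asboolP; have [b hb] := psum_shift r0 q1' qxi (expansionP (coefsP f)).
exists b => x; apply: hb; first exact: (svalP x).
have -> : q * (val x - xi) + (q - 1) * xi = val (qdisk x) - xi.
  by rewrite /= mulrBr mulrBl mul1r addrA subrK.
exact: coefsP.
Qed.
Definition qshift (f : anfun) : anfun := AnFun (qshift_subproof f).

Definition qshiftF (f : merofun) : merofun :=
  tofrac (qshift (numer f)) /
  tofrac (qshift (denom f)).

Lemma qshiftM (f g : anfun) : qshift (f * g) = qshift f * qshift g.
Proof. exact: val_inj. Qed.

Lemma qshift_neq0 (f : anfun) : f != 0 -> qshift f != 0.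
Proof.
apply: contra_neq => h; apply: val_inj; apply/funext => x.
have q0 : q != 0 by rewrite -vabs_eq0 q1 oner_eq0.
have xd : vabs (q^-1 * val x - xi) < rho%:num.
  have -> : q^-1 * val x - xi = q^-1 * ((val x - xi) - (q - 1) * xi).
    by rewrite mulrBl mul1r opprB addrA subrK mulrBr mulKf.
  rewrite vabsM vabsV q1 invr1 mul1r; apply: vabsD_lt; first exact: (svalP x).
  by rewrite vabsN.
have -> : x = qdisk (mkdisk xd) by apply: val_inj; rewrite /= mulVKf.
exact: (congr1 (fun g : anfun => g (mkdisk xd)) h).
Qed.

Lemma qshiftF_frac (u v : anfun) : v != 0 ->
  qshiftF (tofrac u / tofrac v) = tofrac (qshift u) / tofrac (qshift v).
Proof.
move=> v0; rewrite /qshiftF; apply/eqP.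
rewrite eqr_div ?tofrac_eq0 ?qshift_neq0 ?denom_neq0 //.
by rewrite -!tofracM -!qshiftM numden_cross.
Qed.

Definition dq (f : merofun) : merofun :=
  (qshiftF f - f) / tofrac (ancst (q - 1) * anX).

Definition Gmx mu (Y : 'M[merofun]_mu) (n : nat) : 'M[merofun]_mu :=
  iter n (map_mx dq) Y *m invmx Y.

End QDifference.

End AnalyticFunctions.

Section QNumbers.
Variables (R : realType) (p : nat) (K : padicField R p) (q : K).

Definition qint (n : nat) : K := \sum_(i < n) q ^+ i.
Definition qfact (n : nat) : K := \prod_(1 <= i < n.+1) qint i.

(* {n, s}_p^q.  When 1 <= n < s there is no strictly increasing s-tuple in [1, n]; as
   for {0, s} = 1, one then takes as many lambda's as possible, so that the value is
   1 / |[n]_q^!|.  For s <= n the length minn s n is s. *)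
Definition qbracket (n s : nat) : R :=
  if n == 0%N then 1 else
  sup [set r : R | exists lam : 'I_(minn s n) -> nat,
    [/\ forall i, (1 <= lam i <= n)%N,
        forall i j : 'I_(minn s n), (i < j)%N -> (lam i < lam j)%N
      & r = (vabs (\prod_i qint (lam i)))^-1]].

End QNumbers.

(* Main.v *)
Require Import Defs.
From HB Require Import structures.
From mathcomp Require Import all_boot all_order all_algebra.
From mathcomp Require Import ring.
From mathcomp Require Import all_classical all_reals all_analysis.

(* Write D_n = d_q^n / [n]_q^!.  For |(q-1) xi| <= r < rho the Gauss norm of radius r
   is multiplicative and invariant under x |-> qx, so by the Leibniz formula
   D_n(fg) = sum_j sigma^j(D_{n-j} f) D_j g the set of f with |D_n f| <= r^-n |f| for
   all n is stable under products and inverses.  It contains the constants and x - xi,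
   hence the polynomials, hence by density A_D, hence M_D.

   Given a tuple u of mu elements of M_D (a row of Y), divide by a nonzero entry and
   apply d_q: the entry becomes 0 and a tuple of length mu - 1 remains.  By induction
   D_s u is a combination of u, d_q u, ..., d_q^(mu-1) u whose i-th coefficient has norm
   at most {s, mu-1} r^(i-s).  Multiplying by Y^-1 gives the inequality at radius r,
   and r -> rho gives the theorem. *)

Set Implicit Arguments.
Unset Strict Implicit.
Unset Printing Implicit Defensive.
Import Order.TTheory GRing.Theory Num.Theory.
Import numFieldNormedType.Exports.
Local Open Scope classical_set_scope.
Local Open Scope ring_scope.

(** * The q-integers and a recursive form of {n, s}_p^q *)

Section QIntegers.
Variables (R : realType) (p : nat) (K : padicField R p) (q : K).
Hypothesis q1 : vabs q = 1.
Hypothesis q_nroot1 : forall n : nat, (0 < n)%N -> q ^+ n != 1.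

Lemma qint0 : qint q 0 = 0. Proof. by rewrite /qint big_ord0. Qed.

Lemma qint1 : qint q 1 = 1. Proof. by rewrite /qint big_ord1. Qed.

Lemma qfact0 : qfact q 0 = 1. Proof. by rewrite /qfact big_geq. Qed.

Lemma qfactS n : qfact q n.+1 = qfact q n * qint q n.+1.
Proof. by rewrite /qfact big_nat_recr. Qed.

Lemma qintD m n : qint q (m + n) = qint q m + q ^+ m * qint q n.
Proof.
rewrite /qint big_split_ord mulr_sumr; congr (_ + _).
by apply: eq_bigr => i _; rewrite exprD.
Qed.

Lemma vabs_qint_le1 n : vabs (qint q n) <= 1.
Proof. by apply: vabs_sum_le => // i _; rewrite vabsX q1 expr1n. Qed.

Lemma qsub1_neq0 : q - 1 != 0.
Proof. by rewrite subr_eq0 -[q]expr1 q_nroot1. Qed.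

Lemma qint_neq0 n : qint q n.+1 != 0.
Proof.
have := q_nroot1 (ltn0Sn n); rewrite -subr_eq0 subrX1.
by rewrite mulf_eq0 negb_or => /andP[].
Qed.

Lemma qfact_neq0 n : qfact q n != 0.
Proof.
by elim: n => [|n ih]; rewrite ?qfact0 ?oner_eq0 // qfactS mulf_neq0 ?qint_neq0.
Qed.

(** The quotient is a product of q-integers, each of absolute value at most 1. It is the factor
    produced when iterates of [qder] are traded for divided powers. *)
Lemma vabs_qfact_div_le1 k i : (k <= i)%N -> vabs (qfact q i / qfact q k) <= 1.
Proof.
move=> /subnK <-; elim: (i - k)%N => [|j ih].
  by rewrite add0n divff ?qfact_neq0 // vabs1.
rewrite addSn qfactS mulrAC vabsM mulr_ile1 ?vabs_ge0 //.
exact: vabs_qint_le1.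
Qed.

(* The recursion satisfied by {n, s}_p^q: an optimal increasing tuple in [1, n + 1]
   either avoids n + 1 or ends with it. *)
Fixpoint qbound (n s : nat) : R :=
  match n, s with
  | m.+1, t.+1 => Num.max (qbound m s) (qbound m t / vabs (qint q n))
  | _, _ => 1
  end.

Lemma qbound_ge1 n s : 1 <= qbound n s.
Proof. by elim: n s => [|n ih] [|s] //=; rewrite le_max ih. Qed.

Lemma qbound_ge0 n s : 0 <= qbound n s.
Proof. exact: le_trans ler01 (qbound_ge1 n s). Qed.

Lemma qbound_leS n s : qbound n s <= qbound n.+1 s.
Proof. by case: s => [|s]; [case: n|rewrite /= le_max lexx]. Qed.

Lemma qbound_le_n m n s : (m <= n)%N -> qbound m s <= qbound n s.
Proof.
move=> /subnK <-; elim: (n - m)%N => [|k ih]; first by rewrite add0n.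
by rewrite addSn; apply: le_trans ih (qbound_leS _ _).
Qed.

Lemma qbound_le_s n s : qbound n s <= qbound n s.+1.
Proof.
elim: n s => [|n ih] [|s] //; first exact: qbound_ge1.
rewrite /= ge_max !le_max ih /= ler_wpM2r ?orbT //.
by rewrite invr_ge0 vabs_ge0.
Qed.

Lemma qbound_step n s : qbound n s / vabs (qint q n.+1) <= qbound n.+1 s.+1.
Proof. by rewrite /= le_max lexx orbT. Qed.

(** The branch of the recursion tells whether n + 1 is appended. Claiming only an inequality leaves
    room to append n + 1 for free, as |[n+1]_q| <= 1. *)
Lemma qbound_attained n s : exists l : seq nat,
  [/\ size l = minn s n, sorted ltn l, all (fun k => 1 <= k <= n)%N l &
      qbound n s <= (vabs (\prod_(k <- l) qint q k))^-1].
Proof.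
have rc m l : sorted ltn l -> all (fun k => 1 <= k <= m)%N l ->
    sorted ltn (rcons l m.+1) /\ all (fun k => 1 <= k <= m.+1)%N (rcons l m.+1).
  move=> sl al; split.
    rewrite -cats1 (sorted_pairwise ltn_trans) pairwise_cat /= allrel1r.
    rewrite -(sorted_pairwise ltn_trans) sl !andbT.
    by apply: sub_all al => k /andP[_]; rewrite ltnS.
  rewrite all_rcons ltnSn /=; apply: sub_all al => k /andP[-> /= km].
  exact: leqW.
have app n0 l : vabs (\prod_(k <- rcons l n0.+1) qint q k) =
    vabs (\prod_(k <- l) qint q k) * vabs (qint q n0.+1).
  by rewrite -cats1 big_cat big_seq1 vabsM.
elim: n s => [|n ih] [|s]; try by exists [::]; rewrite big_nil vabs1 invr1.
rewrite /=; case: leP => _.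
  have [l [sl so al hl]] := ih s; have [h1 h2] := rc n l so al.
  exists (rcons l n.+1); split=> //; first by rewrite size_rcons sl minnSS.
  by rewrite app invfM ler_wpM2r // invr_ge0 vabs_ge0.
have [l [sl so al hl]] := ih s.+1; have [sn|ns] := leqP s.+1 n.
  exists l; split=> //; first by rewrite sl !(minn_idPl _) ?ltnS // ltnW.
  by apply: sub_all al => k /andP[-> /= km]; exact: leqW.
(* Here s >= n: the length must grow to n + 1 although the maximum skips n + 1. Appending it can
   only enlarge the inverse. *)
have [h1 h2] := rc n l so al.
exists (rcons l n.+1); split=> //.
  by rewrite size_rcons sl !(minn_idPr _) // ltnW.
rewrite app invfM; apply: le_trans hl _.
rewrite ler_peMr ?invr_ge0 ?vabs_ge0 // invf_ge1 ?vabs_qint_le1 //.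
by rewrite lt_neqAle eq_sym vabs_eq0 qint_neq0 vabs_ge0.
Qed.

Lemma qbound_le_qbracket n s : qbound n s <= qbracket q n s.
Proof.
rewrite /qbracket; case: eqP => [->|_]; first by [].
(* [M] dominates each 1/|[k]_q| with k <= n, so a power of it bounds [S]; without an upper bound
   [sup] would not majorize its set. *)
set S := [set r : R | _]; pose M := 1 + \sum_(k < n.+1) (vabs (qint q k))^-1.
have V0 k : 0 <= (vabs (qint q k))^-1 by rewrite invr_ge0 vabs_ge0.
have ubS : ubound S (M ^+ minn s n).
  move=> _ [lam [lam_n _ ->]]; rewrite -vabsV -prodfV.
  rewrite (big_morph (@vabs R p K) (@vabsM R p K) (vabs1 K)).
  rewrite -[X in _ <= _ ^+ X]card_ord -prodr_const; apply: ler_prod => i _.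
  rewrite vabs_ge0 vabsV /M /=; have /andP[_] := lam_n i.
  rewrite -ltnS => ln; rewrite (bigD1 (Ordinal ln)) //= addrCA lerDl.
  by rewrite addr_ge0 ?ler01 // sumr_ge0.
have [l [sl so al hl]] := qbound_attained n s; apply: le_trans hl _.
apply: ub_le_sup; first by exists (M ^+ minn s n).
exists (fun i => nth 0%N l i); split.
- by move=> i; apply: (allP al); rewrite mem_nth ?sl.
- by move=> i j ij; rewrite (sorted_ltn_nth ltn_trans) ?inE ?sl.
- by rewrite (big_nth 0%N) sl big_mkord.
Qed.

End QIntegers.

(** * Twisted derivations of an abstract field and their divided powers *)

Section QDerivation.
Variables (R : realType) (p : nat) (K : padicField R p) (q : K).
Hypothesis q1 : vabs q = 1.
Hypothesis q_nroot1 : forall n : nat, (0 < n)%N -> q ^+ n != 1.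
Variables (F : fieldType) (iota : {rmorphism K -> F}) (sigma : {rmorphism F -> F}).
Variable X : F.
Hypothesis X_neq0 : X != 0.
Hypothesis sigmaX : sigma X = iota q * X.
Hypothesis sigmaC : forall c, sigma (iota c) = iota c.

Definition qder (f : F) : F := (sigma f - f) / (iota (q - 1) * X).

Definition qdder n (f : F) : F := (iota (qfact q n))^-1 * iter n qder f.

Let qX_neq0 : iota (q - 1) * X != 0.
Proof. by rewrite mulf_neq0 // fmorph_eq0 (qsub1_neq0 q_nroot1). Qed.

Let q_neq0 : iota q != 0.
Proof. by rewrite fmorph_eq0 -vabs_eq0 q1 oner_eq0. Qed.

Lemma qderD : {morph qder : f g / f + g}.
Proof. by move=> f g; rewrite /qder rmorphD -mulrDl opprD addrACA. Qed.

Lemma qder0 : qder 0 = 0.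
Proof. by rewrite /qder rmorph0 subrr mul0r. Qed.

Lemma qderM f g : qder (f * g) = sigma f * qder g + qder f * g.
Proof.
by rewrite /qder rmorphM mulrA [(sigma f - f) / _ * g]mulrAC -mulrDl; congr (_ / _); ring.
Qed.

Lemma qderC c : qder (iota c) = 0.
Proof. by rewrite /qder sigmaC subrr mul0r. Qed.

Lemma qderZ c f : qder (iota c * f) = iota c * qder f.
Proof. by rewrite qderM qderC mul0r addr0 sigmaC. Qed.

(** The factor q appears because [sigma] multiplies the denominator (q - 1) X by q. *)
Lemma qder_sigma f : qder (sigma f) = iota q * sigma (qder f).
Proof.
rewrite /qder fmorph_div rmorphM sigmaC sigmaX (rmorphB sigma).
by rewrite [iota (q - 1) * (_ * _)]mulrCA [(iota q * _)^-1]invfM mulrCA mulVKf.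
Qed.

Lemma qder_iter_sigma j f : qder (iter j sigma f) = iota (q ^+ j) * iter j sigma (qder f).
Proof.
elim: j => [|j ih] in f *; first by rewrite expr0 rmorph1 mul1r.
by rewrite !iterS qder_sigma ih rmorphM sigmaC mulrA exprS rmorphM.
Qed.

Lemma iter_sigmaZ j c f : iter j sigma (iota c * f) = iota c * iter j sigma f.
Proof. by elim: j => //= j ->; rewrite rmorphM sigmaC. Qed.

Lemma qder_sum (I : Type) (s : seq I) (G : I -> F) :
  qder (\sum_(i <- s) G i) = \sum_(i <- s) qder (G i).
Proof. exact: (big_morph qder qderD qder0). Qed.

Lemma iter_qderD n : {morph iter n qder : f g / f + g}.
Proof. by move=> f g; elim: n => //= n ->; rewrite qderD. Qed.

Lemma iter_qder0 n : iter n qder 0 = 0.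
Proof. by elim: n => //= n ->; rewrite qder0. Qed.

Lemma iter_qderZ n c f : iter n qder (iota c * f) = iota c * iter n qder f.
Proof. by elim: n => //= n ->; rewrite qderZ. Qed.

Lemma qdder0E f : qdder 0 f = f.
Proof. by rewrite /qdder qfact0 rmorph1 invr1 mul1r. Qed.

Lemma qder_qdder n f : qder (qdder n f) = iota (qint q n.+1) * qdder n.+1 f.
Proof.
rewrite /qdder -fmorphV qderZ qfactS rmorphM invfM fmorphV iterS.
rewrite [(iota (qfact q n))^-1 / _]mulrC -mulrA mulVKf //.
by rewrite fmorph_eq0 (qint_neq0 q_nroot1).
Qed.

Lemma qdderSr n f : qdder n.+1 f = (iota (qint q n.+1))^-1 * qdder n (qder f).
Proof. by rewrite /qdder qfactS rmorphM invfM mulrA [_^-1 * _^-1]mulrC iterSr. Qed.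

Lemma iter_qderE n f : iter n qder f = iota (qfact q n) * qdder n f.
Proof. by rewrite /qdder mulVKf // fmorph_eq0 (qfact_neq0 q_nroot1). Qed.

Lemma qdderD n : {morph qdder n : f g / f + g}.
Proof. by move=> f g; rewrite /qdder iter_qderD mulrDr. Qed.

Lemma qdder0 n : qdder n 0 = 0.
Proof. by rewrite /qdder iter_qder0 mulr0. Qed.

Lemma qdderC n c : qdder n.+1 (iota c) = 0.
Proof. by rewrite /qdder iterSr qderC iter_qder0 mulr0. Qed.

(** By induction, through [n+1]_q = [j]_q + q^j [n+1-j]_q; cancelling [n+1]_q is allowed since q is
    not a root of unity. *)
Lemma qdderM n f g : qdder n (f * g) =
  \sum_(j < n.+1) iter j sigma (qdder (n - j) f) * qdder j g.
Proof.
elim: n => [|n ih]; first by rewrite big_ord1 !qdder0E.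
apply: (mulfI (_ : iota (qint q n.+1) != 0)).
  by rewrite fmorph_eq0 (qint_neq0 q_nroot1).
rewrite -qder_qdder ih qder_sum.
pose T j := iter j sigma (qdder (n.+1 - j) f) * qdder j g.
(* Differentiating the j-th product gives [j+1]_q [T (j+1)] and q^j [n+1-j]_q [T j]. The two
   boundary terms added here vanish because [0]_q = 0. *)
transitivity (\sum_(j < n.+2) iota (qint q j) * T j +
              \sum_(j < n.+2) iota (q ^+ j * qint q (n.+1 - j)) * T j).
  rewrite [X in _ = X + _]big_ord_recl /= qint0 rmorph0 mul0r add0r.
  rewrite [X in _ = _ + X]big_ord_recr /= subnn qint0 mulr0 rmorph0 mul0r addr0.
  rewrite -big_split; apply: eq_bigr => j _ /=.
  have jn : (j <= n)%N by rewrite -ltnS.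
  rewrite qderM qder_qdder qder_iter_sigma qder_qdder /T /bump /= add1n subSS.
  rewrite (subSn jn); congr (_ + _); first by rewrite mulrCA.
  by rewrite iter_sigmaZ (rmorphM iota) !mulrA.
rewrite -big_split mulr_sumr; apply: eq_bigr => j _ /=.
by rewrite -mulrDl -rmorphD -qintD subnKC // -ltnS.
Qed.

(** * Estimates for a multiplicative ultrametric norm invariant under [sigma] *)

Section Norm.
Variable N : F -> R.
Hypothesis N_ge0 : forall f, 0 <= N f.
Hypothesis N_gt0 : forall f : F, f != 0 -> 0 < N f.
Hypothesis NM : {morph N : f g / f * g}.
Hypothesis ND : forall f g, N (f + g) <= Num.max (N f) (N g).
Hypothesis NC : forall c, N (iota c) = vabs c.
Hypothesis Nsigma : forall f, N (sigma f) = N f.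
Variable r : R.
Hypothesis r_gt0 : 0 < r.

Let r_ge0 : 0 <= r := ltW r_gt0.

Let N0 : N 0 = 0.
Proof. by rewrite -(rmorph0 iota) NC vabs0. Qed.

Let N1 : N 1 = 1.
Proof. by rewrite -(rmorph1 iota) NC vabs1. Qed.

Let NN f : N (- f) = N f.
Proof. by rewrite -mulN1r NM -(rmorph1 iota) -rmorphN NC vabsN vabs1 mul1r. Qed.

Let NV (f : F) : f != 0 -> N f^-1 = (N f)^-1.
Proof.
move=> f0; have nf0 : N f != 0 by rewrite gt_eqF ?N_gt0.
by apply: (mulfI nf0); rewrite -NM !mulfV.
Qed.

(** The weight [c] stands for a power of [r], so that the estimates below need no division. *)
Lemma norm_sum_le (I : Type) (s : seq I) (P : pred I) (G : I -> F) (c B : R) :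
  0 <= c -> 0 <= B -> (forall i, P i -> N (G i) * c <= B) ->
  N (\sum_(i <- s | P i) G i) * c <= B.
Proof.
move=> c0 B0 h; apply: (big_ind (fun z => N z * c <= B)) => //.
  by rewrite N0 mul0r.
move=> f g hf hg; apply: le_trans (_ : Num.max (N f) (N g) * c <= B).
  by rewrite ler_wpM2r.
by rewrite maxr_pMl // ge_max hf.
Qed.

Let Niter_sigma j f : N (iter j sigma f) = N f.
Proof. by elim: j => //= j <-; rewrite Nsigma. Qed.

Definition qder_contracting f := forall n, N (qdder n f) * r ^+ n <= N f.

Lemma qder_contractingM f g :
  qder_contracting f -> qder_contracting g -> qder_contracting (f * g).
Proof.
move=> hf hg n; rewrite qdderM; apply: norm_sum_le; rewrite ?exprn_ge0 //.
move=> j _; have jn : (j <= n)%N by rewrite -ltnS.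
have -> : r ^+ n = r ^+ (n - j) * r ^+ j by rewrite -exprD subnK.
rewrite (NM f) NM Niter_sigma mulrACA.
by apply: ler_pM; rewrite ?mulr_ge0 ?exprn_ge0 ?N_ge0 ?hf ?hg.
Qed.

Lemma qder_contractingC c : qder_contracting (iota c).
Proof.
case=> [|n]; first by rewrite qdder0E mulr1.
by rewrite qdderC N0 mul0r.
Qed.

Lemma qder_contractingX f n : qder_contracting f -> qder_contracting (f ^+ n).
Proof.
move=> hf; elim: n => [|n ih].
  by rewrite expr0 -(rmorph1 iota); apply: qder_contractingC.
by rewrite exprS; apply: qder_contractingM.
Qed.

(** Leibniz applied to f^-1 f = 1 expresses D_n(f^-1) f through the D_k(f^-1) with k < n, whence a
    strong induction. *)
Lemma qder_contractingV f : qder_contracting f -> qder_contracting f^-1.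
Proof.
have [->|f0] := eqVneq f 0; first by rewrite invr0.
move=> hf n; have Nf := N_gt0 f0; have nf0 : N f != 0 by rewrite gt_eqF.
elim/ltn_ind: n => -[_|n ih]; first by rewrite qdder0E mulr1.
have := qdderM n.+1 f^-1 f; rewrite mulVf // -(rmorph1 iota) qdderC.
rewrite big_ord_recl /= subn0 qdder0E => /esym/eqP; rewrite addr_eq0 => /eqP h.
rewrite NV // -(ler_pM2r Nf) mulVf ?gt_eqF // mulrAC -NM h NN.
apply: norm_sum_le; rewrite ?exprn_ge0 ?ler01 // => j _.
rewrite /bump add1n subSS; have jn : (j <= n)%N by rewrite -ltnS.
have -> : r ^+ n.+1 = r ^+ (n - j) * r ^+ j.+1 by rewrite -exprD addnS subnK.
rewrite -iterS NM Niter_sigma mulrACA -(mulVf nf0) -NV //.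
apply: ler_pM; rewrite ?mulr_ge0 ?exprn_ge0 //.
by apply: ih; rewrite ltnS leq_subr.
Qed.

(** As d_q(X - c) = 1, only the orders 0 and 1 survive, and order 1 is exactly the hypothesis on
    [r]. *)
Lemma qder_contracting_lin c : r <= N (X - iota c) -> qder_contracting (X - iota c).
Proof.
have d1 : qder (X - iota c) = iota 1.
  rewrite rmorph1 /qder rmorphB sigmaX sigmaC opprB addrA subrK.
  by rewrite -{2}[X]mul1r -mulrBl -(rmorph1 iota) -rmorphB divff // rmorph1.
move=> h [|[|n]]; first by rewrite qdder0E mulr1.
  by rewrite qdderSr d1 qdder0E -fmorphV -rmorphM NC qint1 invr1 mulr1 vabs1 mul1r.
by rewrite qdderSr d1 qdderC mulr0 N0 mul0r.
Qed.

(** The second hypothesis rules out cancellation in the sum; the monomials of a polynomial satisfy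
    it for a Gauss norm. *)
Lemma qder_contracting_sum (I : Type) (s : seq I) (G : I -> F) :
  (forall i, qder_contracting (G i)) ->
  (forall i, N (G i) <= N (\sum_(i <- s) G i)) ->
  qder_contracting (\sum_(i <- s) G i).
Proof.
move=> hG hN n; rewrite (big_morph (qdder n) (qdderD n) (qdder0 n)).
apply: norm_sum_le; rewrite ?exprn_ge0 // => i _.
exact: le_trans (hG i n) (hN i).
Qed.

(** A crude bound from |sigma f - f| <= |f|, with a constant depending on n. It provides the
    continuity of D_n for the density argument. *)
Lemma qdder_bounded n : exists2 C, 0 < C & forall f, N (qdder n f) <= C * N f.
Proof.
elim: n => [|n [C C0 hC]]; first by exists 1 => // f; rewrite qdder0E mul1r.
pose b := N (iota (qint q n.+1) * (iota (q - 1) * X)).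
have b0 : 0 < b by rewrite N_gt0 // mulf_neq0 // fmorph_eq0 (qint_neq0 q_nroot1).
exists (C / b) => [|f]; first exact: divr_gt0.
rewrite mulrAC ler_pdivlMr //.
have -> : N (qdder n.+1 f) * b = N (sigma (qdder n f) - qdder n f).
  rewrite -NM mulrA [qdder n.+1 f * _]mulrC -qder_qdder /qder divfK //.
by apply: le_trans (ND _ _) _; rewrite NN Nsigma maxxx.
Qed.

Lemma qder_contracting_dense f :
  (forall e, 0 < e -> exists2 g, qder_contracting g & N (f - g) <= e) ->
  qder_contracting f.
Proof.
have [-> _ n|f0 h n] := eqVneq f 0; first by rewrite qdder0 N0 mul0r.
have [C C0 hC] := qdder_bounded n; have Nf := N_gt0 f0.
have Cr : 0 < C * r ^+ n by rewrite mulr_gt0 ?exprn_gt0.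
(* Distance at most |f| gives |g| <= |f|; distance at most |f| / (C r^n) gives |D_n(f - g)| r^n <=
   |f|. *)
have [|g hg fg] := h (Num.min (N f) (N f / (C * r ^+ n))).
  by rewrite lt_min Nf divr_gt0.
move: fg; rewrite le_min ler_pdivlMr // => /andP[fg1 fg2].
have gf : N g <= N f.
  rewrite -(subKr f g) addrC; apply: le_trans (ND _ _) _.
  by rewrite NN ge_max fg1 lexx.
rewrite -(subrK g f) {1}addrC qdderD subrK.
apply: le_trans (_ : Num.max (N (qdder n g)) (N (qdder n (f - g))) * r ^+ n <= _).
  by rewrite ler_wpM2r ?exprn_ge0.
rewrite maxr_pMl ?exprn_ge0 // ge_max (le_trans (hg n) gf) /=.
by apply: le_trans fg2; rewrite mulrCA mulrA ler_wpM2r ?exprn_ge0.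
Qed.

Hypothesis contr : forall f, qder_contracting f.

(* Dividing by the first entry makes it constant, so applying [qder] shortens the
   tuple; this costs one factor [1 / [s]_q] per entry. *)
Lemma qdder_span (u : seq F) : exists c : nat -> nat -> F,
  (forall s i, (i < size u)%N ->
     N (c s i) * r ^+ s <= qbound q s (size u).-1 * r ^+ i) /\
  (forall s x, x \in u ->
     qdder s x = \sum_(i < size u) c s i * iter i qder x).
Proof.
have [m] := ubnP (size u); elim: m u => // m IH [|a u] /=; first by exists (fun _ _ => 0).
rewrite ltnS => um.
have [a0|a0] := eqVneq a 0.
  have [c [cB cE]] := IH u um.
  (* Every D_s kills a zero entry, so the coefficients of the shorter tuple are padded by 0;
     [qbound] grows with the length. *)
  exists (fun s i => if (i < size u)%N then c s i else 0); split=> [s i _|s x].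
    case: ifP => iu; last by rewrite N0 mul0r mulr_ge0 ?qbound_ge0 ?exprn_ge0.
    apply: le_trans (cB s i iu) _; rewrite ler_wpM2r ?exprn_ge0 //.
    by case: (size u) iu => // k _; apply: qbound_le_s.
  rewrite inE a0 => /predU1P[->|xu].
    by rewrite qdder0 big1 // => i _; rewrite iter_qder0 mulr0.
  rewrite big_ord_recr /= ltnn mul0r addr0 cE //; apply: eq_bigr => i _.
  by rewrite ltn_ord.
pose w := [seq qder (a^-1 * x) | x <- u].
have [|c [cB cE]] := IH w; first by rewrite size_map.
rewrite size_map in cB cE; set mu := size u in um cB cE *.
(* D_(s+1) y = D_s(d_q y) / [s+1]_q shifts both indices of [c]; order 0 is y itself. *)
pose c1 s i : F := match s, i with
  | s'.+1, i'.+1 => (iota (qint q s))^-1 * c s' i'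
  | 0, 0 => 1
  | _, _ => 0
  end.
have c1B s i : (i < mu.+1)%N -> N (c1 s i) * r ^+ s <= qbound q s mu * r ^+ i.
  have pos : 0 <= qbound q s mu * r ^+ i by rewrite mulr_ge0 ?qbound_ge0 ?exprn_ge0.
  case: s i pos => [|s] [|i] pos; rewrite /c1 ?N0 ?mul0r // ?N1 ?mulr1 ?qbound_ge1 //.
  rewrite ltnS => imu; rewrite NM -fmorphV NC vabsV.
  have := cB s i imu; case: (mu) imu => // k _ /= h.
  rewrite !exprS mulrCA [leRHS]mulrCA ler_pM2l // -mulrA.
  apply: le_trans (_ : (vabs (qint q s.+1))^-1 * (qbound q s k * r ^+ i) <= _).
    by rewrite ler_wpM2l ?invr_ge0 ?vabs_ge0.
  by rewrite mulrA [_^-1 * _]mulrC ler_wpM2r ?exprn_ge0 // qbound_step.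
have c1E s x : x \in a :: u ->
    qdder s (a^-1 * x) = \sum_(i < mu.+1) c1 s i * iter i qder (a^-1 * x).
  move=> xau; rewrite big_ord_recl; case: s => [|s] /=.
    rewrite qdder0E mul1r big1 ?addr0 // => i _; by rewrite mul0r.
  rewrite mul0r add0r qdderSr.
  move: xau; rewrite inE => /predU1P[->|xu].
    rewrite mulVf // -(rmorph1 iota) qderC qdder0 mulr0 big1 // => i _.
    by rewrite -iterS iterSr qderC iter_qder0 mulr0.
  rewrite cE; last by apply/mapP; exists x.
  by rewrite mulr_sumr; apply: eq_bigr => i _; rewrite mulrA -iterSr.
(* Expand D_s x by Leibniz with x = a (a^-1 x), rewrite D_j(a^-1 x) by [c1], and expand d_q^i(a^-1
   x) by Leibniz again: [T s j i k] is the contribution to the coefficient of d_q^k x. The quotient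
   of factorials comes from d_q^i = [i]_q^! D_i and D_k = d_q^k / [k]_q^!. *)
pose T s j i k : F := iter j sigma (qdder (s - j) a) * c1 j i *
  (iota (qfact q i / qfact q k) * iter k sigma (qdder (i - k) a^-1)).
exists (fun s k => \sum_(j < s.+1) \sum_(i < mu.+1) if (k <= i)%N then T s j i k else 0).
split=> [s k kmu|s x xau].
  have B0 : 0 <= qbound q s mu * r ^+ k by rewrite mulr_ge0 ?qbound_ge0 ?exprn_ge0.
  apply: norm_sum_le; rewrite ?exprn_ge0 // => j _.
  apply: norm_sum_le; rewrite ?exprn_ge0 // => i _.
  case: ifP => ki; last by rewrite N0 mul0r.
  have js : (j <= s)%N by rewrite -ltnS.
  have Na := N_gt0 a0.
  have h1 := contr a (s - j)%N; have h2 := c1B j i (ltn_ord i).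
  have h3 := contr a^-1 (i - k)%N; rewrite NV // in h3.
  have h4 := vabs_qfact_div_le1 q1 q_nroot1 ki.
  rewrite /T (NM (_ * _)) (NM (iter _ _ _)) [N (iota _ * _)]NM NC !Niter_sigma.
  (* The extra power r^(i-k) gives each divided power its own weight; the bounds |a| and |a|^-1 then
     cancel. *)
  rewrite -(ler_pM2r (exprn_gt0 (i - k) r_gt0)).
  rewrite -[X in _ <= X]mulrA -exprD subnKC //.
  have -> : r ^+ s = r ^+ (s - j) * r ^+ j by rewrite -exprD subnK.
  set A := N (qdder (s - j) a) in h1 *; set C := N (c1 j i) in h2 *.
  set D := N (qdder (i - k) _) in h3 *; set V := vabs _ in h4 *.
  have -> : A * C * (V * D) * (r ^+ (s - j) * r ^+ j) * r ^+ (i - k) =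
    (A * r ^+ (s - j)) * (C * r ^+ j) * V * (D * r ^+ (i - k)) by ring.
  apply: le_trans (_ : N a * (qbound q j mu * r ^+ i) * 1 * (N a)^-1 <= _).
    apply: ler_pM; rewrite ?mulr_ge0 ?exprn_ge0 ?N_ge0 ?vabs_ge0 //.
    apply: ler_pM; rewrite ?mulr_ge0 ?exprn_ge0 ?N_ge0 ?vabs_ge0 //.
    by apply: ler_pM; rewrite ?mulr_ge0 ?exprn_ge0 ?N_ge0 ?vabs_ge0.
  rewrite mulr1 mulrC mulKf ?gt_eqF // ler_wpM2r ?exprn_ge0 //.
  exact: qbound_le_n.
rewrite -{1}(mulVKf a0 x) qdderM.
under [RHS]eq_bigr do rewrite mulr_suml.
rewrite exchange_big /=; apply: eq_bigr => j _.
rewrite (c1E j x xau) mulr_sumr.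
under [RHS]eq_bigr do rewrite mulr_suml.
rewrite exchange_big /=; apply: eq_bigr => i _.
pose G k := iter k sigma (qdder (i - k) a^-1) * qdder k x.
rewrite iter_qderE qdderM (big_ord_widen mu.+1 G) // !mulr_sumr.
rewrite big_mkcond; apply: eq_bigr => k _ /=; rewrite ltnS.
case: ifP => // ki; last by rewrite mul0r.
by rewrite /T /G [qdder k x]/qdder (rmorphM iota) fmorphV; ring.
Qed.

End Norm.

End QDerivation.

(** * Gauss norms of analytic functions and polynomials *)

Section GaussNorm.
Variables (R : realType) (p : nat) (K : padicField R p).
Variables (xi : K) (rho : {posnum R}).
Local Notation anfun := (anfun xi rho).
Implicit Types (f g : anfun) (r : R) (P : {poly K}).

Lemma gauss_le f r B :
  (forall n, vabs (coefs f n) * r ^+ n <= B) -> gauss f r <= B.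
Proof.
move=> h; apply: ge_sup; first by exists (vabs (coefs f 0) * r ^+ 0), 0%N.
by move=> _ [n _ <-].
Qed.

Lemma coefs0 n : coefs (0 : anfun) n = 0.
Proof. exact: expansion_eq0 (coefsP 0) n. Qed.

Lemma coefsB f g n : coefs (f - g) n = coefs f n - coefs g n.
Proof.
by rewrite (coefs_unique (f := f - g) (expansionB (coefsP f) (coefsP g))).
Qed.

Lemma coefsD f g n : coefs (f + g) n = coefs f n + coefs g n.
Proof. by rewrite -[in LHS](opprK g) coefsB -sub0r coefsB coefs0 sub0r opprK. Qed.

Lemma coefs_ancst c n : coefs (ancst xi rho c) n = if n == 0%N then c else 0.
Proof. by rewrite (coefs_unique (f := ancst xi rho c) (@expansion_cst _ _ _ _ _ c)). Qed.

Lemma expansion_poly P :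
  expansion (fun x : disk xi rho => P.[val x - xi]) (fun n => P`_n).
Proof.
move=> x; apply/vcvgP => e e0; exists (size P) => n Pn.
by rewrite /psum -(horner_coef_wide _ Pn) subrr vabs0.
Qed.

Lemma analytic_poly P :
  (fun x : disk xi rho => P.[val x - xi]) \in analytic (xi := xi) (rho := rho).
Proof. by apply/asboolP; eexists; exact: expansion_poly. Qed.

Definition anpoly P : anfun := AnFun (analytic_poly P).

Lemma coefs_anpoly P n : coefs (anpoly P) n = P`_n.
Proof. by rewrite (coefs_unique (f := anpoly P) (expansion_poly P)). Qed.

(** In this form the closure properties of contracting elements apply to polynomials. *)
Lemma anpolyE P :
  anpoly P = \sum_(i < size P) ancst xi rho P`_i * (anX xi rho - ancst xi rho xi) ^+ i.
Proof.
apply: val_inj; apply/funext => x /=; rewrite horner_coef.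
have vs (I : Type) (s : seq I) (G : I -> anfun) :
    (\sum_(i <- s) G i : anfun) x = \sum_(i <- s) G i x.
  by elim/big_rec2: _ => // i y1 y2 _ <-.
rewrite [RHS]vs; apply: eq_bigr => i _.
have vX (g : anfun) n : (g ^+ n) x = g x ^+ n.
  by elim: n => // n ih; rewrite !exprS -ih.
transitivity (P`_i * ((anX xi rho - ancst xi rho xi : anfun) ^+ i) x) => //.
by rewrite vX.
Qed.

Section Radius.
Variable r : R.
Hypothesis r_gt0 : 0 < r.
Hypothesis r_lt : r < rho%:num.

Lemma coefs_le_gauss f n : vabs (coefs f n) * r ^+ n <= gauss f r.
Proof.
have [->|f0] := eqVneq f 0; first by rewrite coefs0 vabs0 mul0r gauss0.
by have [m [_ _ h _]] := gauss_max r_gt0 r_lt f0.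
Qed.

Lemma gauss_ge0 f : 0 <= gauss f r.
Proof.
apply: le_trans (coefs_le_gauss f 0).
by rewrite mulr_ge0 ?vabs_ge0 ?exprn_ge0 ?ltW.
Qed.

Lemma gauss_gt0 f : f != 0 -> 0 < gauss f r.
Proof. by move=> f0; have [m []] := gauss_max r_gt0 r_lt f0. Qed.

Lemma gaussD f g : gauss (f + g) r <= Num.max (gauss f r) (gauss g r).
Proof.
have rn n : 0 <= r ^+ n by rewrite exprn_ge0 ?ltW.
apply: gauss_le => n; rewrite coefsD.
apply: le_trans (ler_wpM2r (rn n) (vabs_ultra _ _)) _.
rewrite maxr_pMl // ge_max !le_max !coefs_le_gauss /=.
by rewrite orbT.
Qed.

Lemma gauss_ancst c : gauss (ancst xi rho c) r = vabs c.
Proof.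
apply/eqP; rewrite eq_le; apply/andP; split; last first.
  by apply: le_trans (coefs_le_gauss _ 0); rewrite coefs_ancst /= mulr1.
apply: gauss_le => -[|n]; rewrite coefs_ancst /= ?mulr1 // vabs0 mul0r.
exact: vabs_ge0.
Qed.

(** Density of polynomials: truncations suffice, since |a_n| r^n tends to 0 for r < rho. *)
Lemma gauss_anpoly_small f e : 0 < e ->
  exists P, gauss (f - anpoly P) r <= e.
Proof.
move=> e0; have [M hM] := coefs_lim f r_gt0 r_lt e0.
exists (\poly_(i < M) coefs f i); apply: gauss_le => n.
rewrite coefsB coefs_anpoly coef_poly; case: ltnP => nM.
  by rewrite subrr vabs0 mul0r ltW.
by rewrite subr0 ltW // hM.
Qed.

Lemma gauss_subX : gauss (anX xi rho - ancst xi rho xi) r = r.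
Proof.
have -> : anX xi rho - ancst xi rho xi = anpoly 'X.
  by apply: val_inj; apply/funext => x /=; rewrite hornerX.
apply/eqP; rewrite eq_le; apply/andP; split; last first.
  by apply: le_trans (coefs_le_gauss _ 1); rewrite coefs_anpoly coefX vabs1 mul1r.
apply: gauss_le => n; rewrite coefs_anpoly coefX; case: eqP => [->|_].
  by rewrite vabs1 mul1r.
by rewrite vabs0 mul0r ltW.
Qed.

End Radius.

(** The coefficients are Cauchy; their limits form a power series that also sums to f, and
    expansions are unique. This identifies the expansion of f(qx), of which [qshift] records only
    the existence. *)
Lemma coefs_poly_lim f (P : nat -> {poly K}) :
  (forall n, (size (P n) <= n)%N) ->
  (forall y : K, vabs y < rho%:num -> forall e : R, 0 < e -> exists N, forall m n,
     (N <= m)%N -> (N <= n)%N -> forall k, vabs ((P m)`_k - (P n)`_k) * vabs y ^+ k <= e) ->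
  (forall x : disk xi rho, vcvg (fun n => (P n).[val x - xi]) (f x)) ->
  forall k, vcvg (fun n => (P n)`_k) (coefs f k).
Proof.
move=> sP cP fP.
have lim k : exists l, vcvg (fun n => (P n)`_k) l.
  (* Any nonzero y in the disk allows the weight |y|^k to be divided out. *)
  apply: padic_complete => e e0; have [y y0 yr] := @vabs_small _ _ K _ (gt0 rho).
  have yp : 0 < vabs y ^+ k.
    by rewrite exprn_gt0 // lt_neqAle eq_sym vabs_eq0 y0 vabs_ge0.
  have [|N hN] := cP y yr (e / 2 * vabs y ^+ k); first by rewrite mulr_gt0 ?divr_gt0.
  exists N => m n Nm Nn; have := hN m n Nm Nn k; rewrite ler_pM2r // => h.
  by apply: le_lt_trans h _; rewrite ltr_pdivrMr // ltr_pMr // ltr1n.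
pose b k := projT1 (cid (lim k)).
have bP k : vcvg (fun n => (P n)`_k) (b k) by rewrite /b; case: cid.
suff -> : coefs f = b by [].
apply: coefs_unique => x; have xr := svalP x; set y := val x - xi.
apply/vcvgP => e e0.
have e2 : 0 < e / 2 by rewrite divr_gt0.
have [N hN] := cP y xr _ e2.
have /vcvgP/(_ e e0)[M hM] := fP x; exists (maxn N M) => n.
rewrite geq_max => /andP[Nn Mn].
rewrite -[psum b y n](subrK (P n).[y]) -addrA; apply: vabsD_lt; last exact: hM.
apply: (@le_lt_trans _ _ (e / 2)); last by rewrite ltr_pdivrMr // ltr_pMr // ltr1n.
(* As [P n] has size at most n, its value and the partial sum of [b] run over the same indices. *)
rewrite (horner_coef_wide _ (sP n)) /psum -sumrB.
apply: vabs_sum_le; first exact: ltW.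
move=> i _; rewrite -mulrBl.
have hc : vcvg (fun m => ((P m)`_i - (P n)`_i) * y ^+ i) ((b i - (P n)`_i) * y ^+ i).
  have cst (c : K) : vcvg (fun _ : nat => c) c.
    by apply/vcvgP => e' e'0; exists 0%N => k _; rewrite subrr vabs0.
  by apply: vcvgM; [apply: vcvgD; [exact: bP|exact: cst]|exact: cst].
apply: (vcvg_le (N := N) (ltW e2) hc) => m Nm.
by rewrite vabsM vabsX hN.
Qed.

(** At radius r the affine polynomial has Gauss norm at most r, so its n-th power has norm at most
    r^n, and the ultrametric inequality keeps the bound [B]. *)
Lemma comp_affine_le P (c h : K) r B : 0 < r -> vabs c <= 1 -> vabs h <= r ->
  0 <= B -> (forall n, vabs P`_n * r ^+ n <= B) ->
  forall k, vabs (P \Po (c *: 'X + h%:P))`_k * r ^+ k <= B.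
Proof.
move=> r0 c1 hr B0 hB k.
have rn n : 0 < r ^+ n by rewrite exprn_gt0.
set Q := c *: 'X + h%:P.
have Qn n i : vabs (Q ^+ n)`_i * r ^+ i <= r ^+ n.
  elim: n i => [|n ih] i.
    rewrite expr0 coef1; case: i => [|i] /=; first by rewrite vabs1 mulr1.
    by rewrite vabs0 mul0r.
  have -> : (Q ^+ n.+1)`_i = c * (if i is j.+1 then (Q ^+ n)`_j else 0) + h * (Q ^+ n)`_i.
    rewrite exprS /Q mulrDl coefD -scalerAl coefZ coefXM coefCM.
    by case: i.
  rewrite -ler_pdivlMr //; apply: vabsD_le; rewrite ler_pdivlMr // vabsM -mulrA.
    apply: le_trans (_ : vabs (if i is j.+1 then (Q ^+ n)`_j else 0) * r ^+ i <= _).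
      by rewrite ler_piMl // mulr_ge0 ?vabs_ge0 ?ltW.
    case: i => [|j]; first by rewrite vabs0 mul0r ltW.
    by rewrite !exprS mulrCA ler_pM2l.
  rewrite exprS; apply: ler_pM; rewrite ?mulr_ge0 ?vabs_ge0 //.
  exact: ltW.
rewrite coef_comp_poly -ler_pdivlMr //; apply: vabs_sum_le.
  by rewrite divr_ge0 // ltW.
move=> n _; rewrite ler_pdivlMr // vabsM; apply: le_trans (hB n).
by rewrite -mulrA ler_wpM2l ?vabs_ge0.
Qed.

End GaussNorm.

(** * Invariance of the Gauss norm under x |-> qx *)

Section GaussNormShift.
Variables (R : realType) (p : nat) (K : padicField R p).
Variables (xi : K) (rho : {posnum R}).
Local Notation anfun := (anfun xi rho).
Implicit Types (f g : anfun) (r : R).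

(** In y = x - xi the map x |-> qx reads y |-> qy + h with |h| <= r. The bound holds for the
    substituted truncations of f and passes to the limit coefficientwise. *)
Lemma gauss_qshift_le (q : K) (q1 : vabs q = 1) (qxi : vabs ((q - 1) * xi) < rho%:num)
    f r : 0 < r -> r < rho%:num -> vabs ((q - 1) * xi) <= r ->
  gauss (qshift q1 qxi f) r <= gauss f r.
Proof.
move=> r0 rrho hr; set h := (q - 1) * xi in qxi hr *.
pose a := coefs f; pose Q : {poly K} := q *: 'X + h%:P.
pose P n := (\poly_(i < n) a i) \Po Q.
have sQ : (size Q <= 2)%N.
  apply: leq_trans (size_polyD _ _) _; rewrite geq_max.
  rewrite (leq_trans (size_scale_leq _ _)) ?size_polyX //=.
  by rewrite (leq_trans (size_polyC_leq1 _)).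
have sP n : (size (P n) <= n)%N.
  case: n => [|n]; first by rewrite /P poly_def big_ord0 comp_poly0 size_poly0.
  apply: leq_trans (size_comp_poly_leq _ _) _; rewrite ltnS.
  have h1 : ((size (\poly_(i < n.+1) a i)).-1 <= n)%N.
    by rewrite -subn1 leq_subLR add1n size_poly.
  rewrite -[X in (_ <= X)%N]muln1; apply: leq_mul => //.
  by rewrite -subn1 leq_subLR.
have q1' : vabs q <= 1 by rewrite q1.
have cP (y : K) : vabs y < rho%:num -> forall e : R, 0 < e -> exists N, forall m n,
    (N <= m)%N -> (N <= n)%N -> forall k, vabs ((P m)`_k - (P n)`_k) * vabs y ^+ k <= e.
  (* [t] is at least |y| and |h| yet below rho, so tails of f are small at this radius and
     [comp_affine_le] applies. *)
  move=> yr e e0; pose t := Num.max (vabs y) r.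
  have t0 : 0 < t by rewrite lt_max r0 orbT.
  have trho : t < rho%:num by rewrite gt_max yr.
  have [N hN] := coefs_lim f t0 trho e0; exists N => m n Nm Nn k.
  apply: le_trans (_ : vabs ((P m)`_k - (P n)`_k) * t ^+ k <= _).
    by rewrite ler_wpM2l ?vabs_ge0 // lerXn2r ?nnegrE ?vabs_ge0 ?(ltW t0) // le_max lexx.
  rewrite -coefB /P -comp_polyB; apply: comp_affine_le => //; rewrite ?(ltW e0) //.
    by rewrite le_max hr orbT.
  move=> i; rewrite coefB !coef_poly; have [iN|Ni] := ltnP i N.
    by rewrite !(leq_trans iN) // subrr vabs0 mul0r ltW.
  apply: le_trans (ltW (hN i Ni)); rewrite ler_wpM2r ?exprn_ge0 ?(ltW t0) //.
  by apply: vabsB_le; case: ifP => _ //; rewrite vabs0 vabs_ge0.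
have fP (x : disk xi rho) : vcvg (fun n => (P n).[val x - xi]) (qshift q1 qxi f x).
  have := coefsP f (qdisk q1 qxi x); congr vcvg; apply/funext => n.
  rewrite /P horner_comp horner_poly /psum; apply: eq_bigr => i _; congr (_ * _ ^+ _).
  by rewrite /= !hornerE /h mulrBr mulrBl mul1r addrA subrK.
apply: gauss_le => k; rewrite -ler_pdivlMr ?exprn_gt0 //.
have hc := coefs_poly_lim sP cP fP k.
apply: (vcvg_le (N := 0%N) _ hc) => [|n _].
  by rewrite divr_ge0 ?gauss_ge0 ?exprn_ge0 ?ltW.
rewrite ler_pdivlMr ?exprn_gt0 //; apply: comp_affine_le => //.
  exact: gauss_ge0.
move=> i; rewrite coef_poly; case: ifP => _; first exact: coefs_le_gauss.
by rewrite vabs0 mul0r gauss_ge0.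
Qed.

Variables (q : K) (q1 : vabs q = 1) (qxi : vabs ((q - 1) * xi) < rho%:num).

(** The reverse inequality is the previous one for q^-1, since |(q^-1 - 1) xi| = |(q - 1) xi|. *)
Lemma gauss_qshift f r : 0 < r -> r < rho%:num -> vabs ((q - 1) * xi) <= r ->
  gauss (qshift q1 qxi f) r = gauss f r.
Proof.
move=> r0 rrho hr; apply/eqP; rewrite eq_le gauss_qshift_le //=.
have q0 : q != 0 by rewrite -vabs_eq0 q1 oner_eq0.
have q1' : vabs q^-1 = 1 by rewrite vabsV q1 invr1.
have hE : vabs ((q^-1 - 1) * xi) = vabs ((q - 1) * xi).
  have -> : (q^-1 - 1) * xi = q^-1 * - ((q - 1) * xi).
    by rewrite -mulNr opprB mulrA mulrBr mulr1 mulVf.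
  by rewrite (vabsM q^-1) q1' mul1r vabsN.
have qxi' : vabs ((q^-1 - 1) * xi) < rho%:num by rewrite hE.
have {1}-> : f = qshift q1' qxi' (qshift q1 qxi f).
  apply: val_inj; apply/funext => x /=; congr (anfun_val f _).
  by apply: val_inj; rewrite /= mulVKf.
by apply: gauss_qshift_le; rewrite ?hE.
Qed.

End GaussNormShift.

(** * Meromorphic functions as a normed field with a q-derivation *)

Section MeroFun.
Variables (R : realType) (p : nat) (K : padicField R p).
Variables (xi : K) (rho : {posnum R}).
Local Notation anfun := (anfun xi rho).
Local Notation merofun := {fraction anfun}.
Implicit Types (f g : merofun) (u v : anfun) (r : R).

Lemma ancst_zmod_morphism : zmod_morphism (ancst xi rho).
Proof. by move=> c d; exact: val_inj. Qed.
HB.instance Definition _ :=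
  GRing.isZmodMorphism.Build K anfun (ancst xi rho) ancst_zmod_morphism.

Lemma ancst_monoid_morphism : monoid_morphism (ancst xi rho).
Proof. by split=> [|c d]; exact: val_inj. Qed.
HB.instance Definition _ :=
  GRing.isMonoidMorphism.Build K anfun (ancst xi rho) ancst_monoid_morphism.

Definition merocst (c : K) : merofun := FracField.tofrac (ancst xi rho c).
HB.instance Definition _ := GRing.RMorphism.copy merocst
  (@FracField.tofrac anfun \o ancst xi rho).

Lemma merofunP f : exists u v, v != 0 /\ f = FracField.tofrac u / FracField.tofrac v.
Proof. by exists (numer f), (denom f); split; [exact: denom_neq0|exact: numdenE]. Qed.

Lemma merofun_sub u v u' v' : v != 0 -> v' != 0 ->
  FracField.tofrac u / FracField.tofrac v - FracField.tofrac u' / FracField.tofrac v' =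
  FracField.tofrac (u * v' - u' * v) / FracField.tofrac (v * v').
Proof.
move=> v0 v'0.
by rewrite -mulNr addf_div ?tofrac_eq0 // tofracB !tofracM mulNr.
Qed.

Lemma merofun_mul u v u' v' :
  (FracField.tofrac u / FracField.tofrac v) * (FracField.tofrac u' / FracField.tofrac v') =
  FracField.tofrac (u * u') / FracField.tofrac (v * v').
Proof. by rewrite mulf_div !tofracM. Qed.

Section Radius.
Variable r : R.
Hypothesis r_gt0 : 0 < r.
Hypothesis r_lt : r < rho%:num.

Lemma gaussF_tofrac u : gaussF (FracField.tofrac u) r = gauss u r.
Proof.
rewrite -[FracField.tofrac u]divr1 -tofrac1 gaussF_frac ?oner_neq0 //.
by rewrite -(rmorph1 (ancst xi rho)) gauss_ancst // vabs1 divr1.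
Qed.

Lemma gaussF_merocst c : gaussF (merocst c) r = vabs c.
Proof. by rewrite gaussF_tofrac gauss_ancst. Qed.

Lemma gaussF_ge0 f : 0 <= gaussF f r.
Proof. by rewrite divr_ge0 ?gauss_ge0. Qed.

Lemma gaussF_gt0 f : f != 0 -> 0 < gaussF f r.
Proof.
have [u [v [v0 ->]]] := merofunP f; have [->|u0 _] := eqVneq u 0.
  by rewrite tofrac0 mul0r eqxx.
by rewrite gaussF_frac // divr_gt0 ?gauss_gt0.
Qed.

Lemma gaussFM : {morph (fun f => gaussF f r) : f g / f * g}.
Proof.
move=> f g; have [u [v [v0 ->]]] := merofunP f; have [u' [v' [v'0 ->]]] := merofunP g.
by rewrite merofun_mul !gaussF_frac ?mulf_neq0 // !gaussM // mulf_div.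
Qed.

Lemma gaussFD f g : gaussF (f + g) r <= Num.max (gaussF f r) (gaussF g r).
Proof.
have [u [v [v0 ->]]] := merofunP f; have [u' [v' [v'0 ->]]] := merofunP g.
rewrite addf_div ?tofrac_eq0 // -!tofracM -tofracD !gaussF_frac ?mulf_neq0 //.
have gv := gauss_gt0 r_gt0 r_lt v0; have gv' := gauss_gt0 r_gt0 r_lt v'0.
rewrite ler_pdivrMr; last by rewrite gaussM // mulr_gt0.
apply: le_trans (gaussD r_gt0 r_lt _ _) _; rewrite !gaussM //.
rewrite maxr_pMl ?mulr_ge0 ?(ltW gv) ?(ltW gv') // mulrA divfK ?gt_eqF //.
by rewrite [gauss v r * _]mulrC mulrA divfK ?gt_eqF.
Qed.

End Radius.

Variables (q : K) (q1 : vabs q = 1) (qxi : vabs ((q - 1) * xi) < rho%:num).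
Hypothesis q_nroot1 : forall n : nat, (0 < n)%N -> q ^+ n != 1.

Lemma qshiftF_zmod_morphism : zmod_morphism (qshiftF q1 qxi).
Proof.
move=> f g; have [u [v [v0 ->]]] := merofunP f; have [u' [v' [v'0 ->]]] := merofunP g.
rewrite merofun_sub // !qshiftF_frac ?mulf_neq0 // merofun_sub ?qshift_neq0 //.
by congr (FracField.tofrac _ / FracField.tofrac _); exact: val_inj.
Qed.
HB.instance Definition _ :=
  GRing.isZmodMorphism.Build merofun merofun (qshiftF q1 qxi) qshiftF_zmod_morphism.

Lemma qshiftF_tofrac u :
  qshiftF q1 qxi (FracField.tofrac u) = FracField.tofrac (qshift q1 qxi u).
Proof.
rewrite -[FracField.tofrac u]divr1 -tofrac1 qshiftF_frac ?oner_neq0 //.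
have -> : qshift q1 qxi 1 = 1 by exact: val_inj.
by rewrite tofrac1 divr1.
Qed.

Lemma qshiftF_monoid_morphism : monoid_morphism (qshiftF q1 qxi).
Proof.
split=> [|f g].
  by rewrite -tofrac1 qshiftF_tofrac; congr FracField.tofrac; exact: val_inj.
have [u [v [v0 ->]]] := merofunP f; have [u' [v' [v'0 ->]]] := merofunP g.
rewrite merofun_mul !qshiftF_frac ?mulf_neq0 // merofun_mul.
by rewrite !qshiftM.
Qed.
HB.instance Definition _ :=
  GRing.isMonoidMorphism.Build merofun merofun (qshiftF q1 qxi) qshiftF_monoid_morphism.

Local Notation X := (FracField.tofrac (anX xi rho)).

Lemma meroX_neq0 : X != 0.
Proof.
rewrite tofrac_eq0; apply/eqP => h.
have := coefs_unique (f := anX xi rho) (@expansion_id _ _ _ _ _).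
by rewrite h => /(congr1 (fun a => a 1%N)) /eqP; rewrite coefs0 /= eq_sym oner_eq0.
Qed.

Lemma qshiftF_X : qshiftF q1 qxi X = merocst q * X.
Proof.
rewrite qshiftF_tofrac /merocst -tofracM; congr FracField.tofrac; exact: val_inj.
Qed.

Lemma qshiftF_merocst c : qshiftF q1 qxi (merocst c) = merocst c.
Proof. by rewrite qshiftF_tofrac; congr FracField.tofrac; exact: val_inj. Qed.

(** Brings [dq] under the abstract results on [qder]. *)
Lemma dqE : dq q1 qxi = qder q merocst (qshiftF q1 qxi) X.
Proof. by apply/funext => f; rewrite /dq /qder tofracM. Qed.

(** * The inequality at a fixed radius r >= |(q - 1) xi| *)

Section GenericRadius.
Variable r : R.
Hypothesis r_gt0 : 0 < r.
Hypothesis r_lt : r < rho%:num.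
Hypothesis qxi_r : vabs ((q - 1) * xi) <= r.

Lemma gaussF_qshiftF f : gaussF (qshiftF q1 qxi f) r = gaussF f r.
Proof.
have [u [v [v0 ->]]] := merofunP f.
by rewrite qshiftF_frac // !gaussF_frac ?qshift_neq0 // !gauss_qshift.
Qed.

Local Notation contracting :=
  (qder_contracting q merocst (qshiftF q1 qxi) X (fun f => gaussF f r) r).

Lemma contracting_merofun f : contracting f.
Proof.
have ge0 := gaussF_ge0 r_gt0 r_lt; have gt0 := gaussF_gt0 r_gt0 r_lt.
have M := gaussFM r_gt0 r_lt; have D := gaussFD r_gt0 r_lt.
have C := gaussF_merocst r_gt0 r_lt.
have qX := qshiftF_X; have qC := qshiftF_merocst; have qN := gaussF_qshiftF.
have cM := qder_contractingM q1 q_nroot1 qX qC ge0 M D C qN r_gt0.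
have cV := qder_contractingV q1 q_nroot1 qX qC ge0 gt0 M D C qN r_gt0.
have [u [v [v0 ->]]] := merofunP f.
suff an (w : anfun) : contracting (FracField.tofrac w) by apply: cM; [|apply: cV].
apply: (qder_contracting_dense q_nroot1 meroX_neq0 qC gt0 M D C qN r_gt0) => e e0.
have [P hP] := gauss_anpoly_small r_gt0 r_lt w e0.
exists (FracField.tofrac (anpoly xi rho P)); last by rewrite -tofracB gaussF_tofrac.
have PE : FracField.tofrac (anpoly xi rho P) =
    \sum_(i < size P) merocst P`_i * (X - merocst xi) ^+ i.
  rewrite anpolyE rmorph_sum; apply: eq_bigr => i _.
  by rewrite /= tofracM tofracXn tofracB.
(* The condition of [qder_contracting_lin] holds here with equality. *)
have NX : gaussF (X - merocst xi) r = r by rewrite -tofracB gaussF_tofrac // gauss_subX.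
have NXn i : gaussF ((X - merocst xi) ^+ i) r = r ^+ i.
  elim: i => [|i ih]; first by rewrite !expr0 -tofrac1 -(rmorph1 (ancst xi rho)) C vabs1.
  by rewrite !exprS M NX ih.
rewrite PE; apply: (qder_contracting_sum ge0 D C r_gt0) => i.
  apply: cM; first exact: (@qder_contractingC _ _ _ q _ _ _ X qC _ ge0 C r).
  apply: (qder_contractingX q1 q_nroot1 qX qC ge0 M D C qN r_gt0).
  by apply: (qder_contracting_lin q_nroot1 meroX_neq0 qX qC ge0 C); rewrite NX.
(* No cancellation: the i-th term has norm |P_i| r^i, at most the Gauss norm of [P]. *)
rewrite -PE gaussF_tofrac // M C NXn -(coefs_anpoly xi rho).
exact: coefs_le_gauss.
Qed.

(* Only the entries of one row of [Y] enter: they are the tuple of [qdder_span]. *)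
Lemma gaussF_Gmx_le mu (Y : 'M[merofun]_mu) n (i j : 'I_mu) (B : R) : 0 <= B ->
  (forall k : 'I_mu, gaussF (Gmx q1 qxi Y k i j) r * r ^+ k <= B) ->
  gaussF (((merocst (qfact q n))^-1 *: Gmx q1 qxi Y n) i j) r <=
    qbound q n mu.-1 * B / r ^+ n.
Proof.
move=> B0 hB.
have [c [cB cE]] := qdder_span q1 q_nroot1 qshiftF_X qshiftF_merocst
  (gaussF_ge0 r_gt0 r_lt) (gaussF_gt0 r_gt0 r_lt) (gaussFM r_gt0 r_lt)
  (gaussFD r_gt0 r_lt) (gaussF_merocst r_gt0 r_lt) gaussF_qshiftF r_gt0
  contracting_merofun [seq Y i k | k <- enum 'I_mu].
rewrite size_map size_enum_ord in cB cE.
have GE k : Gmx q1 qxi Y k i j =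
    \sum_l iter k (qder q merocst (qshiftF q1 qxi) X) (Y i l) * invmx Y l j.
  rewrite /Gmx mxE; apply: eq_bigr => l _; congr (_ * _).
  by rewrite -dqE; elim: k => //= k ih; rewrite mxE ih.
(* The coefficients [c n k] are common to all entries of row i, so the relation survives
   multiplication by column j of Y^-1. *)
have -> : ((merocst (qfact q n))^-1 *: Gmx q1 qxi Y n) i j =
    \sum_(k < mu) c n k * Gmx q1 qxi Y k i j.
  rewrite mxE GE mulr_sumr.
  under [RHS]eq_bigr do rewrite GE mulr_sumr.
  rewrite exchange_big; apply: eq_bigr => l _ /=.
  rewrite mulrA -/(qdder q merocst (qshiftF q1 qxi) X n (Y i l)) cE; last first.
    by rewrite map_f // mem_enum.
  by rewrite mulr_suml; apply: eq_bigr => k _; rewrite mulrA.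
rewrite ler_pdivlMr ?exprn_gt0 //.
apply: (norm_sum_le (gaussFD r_gt0 r_lt) (gaussF_merocst r_gt0 r_lt)).
- by rewrite exprn_ge0 ?ltW.
- by rewrite mulr_ge0 ?qbound_ge0.
move=> k _; rewrite gaussFM // mulrAC.
apply: le_trans (_ : qbound q n mu.-1 * r ^+ k * gaussF (Gmx q1 qxi Y k i j) r <= _).
  by rewrite ler_wpM2r ?gaussF_ge0 // cB.
by rewrite -mulrA ler_wpM2l ?qbound_ge0 // mulrC.
Qed.

End GenericRadius.
End MeroFun.

(** * The boundary norm as an upper limit *)

Section BoundaryNorm.
Variables (R : realType) (p : nat) (K : padicField R p).
Variables (xi : K) (rho : {posnum R}).
Implicit Types (f : {fraction anfun xi rho}).

Lemma bnorm_lt_near f (b : \bar R) : (bnorm f < b)%E ->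
  \forall r \near rho%:num^'-, ((gaussF f r)%:E < b)%E.
Proof.
rewrite /bnorm limf_esupE => /ereal_inf_lt[_ [V FV <-] hV].
apply: filterS FV => r Vr; apply: le_lt_trans hV.
by apply: ereal_sup_ubound; exists r.
Qed.

(** Only the majorant is asked to converge, because [gaussF f] itself may have no limit at rho. *)
Lemma bnorm_le_lim f (g : R -> R) (l : R) :
  (\forall r \near rho%:num^'-, gaussF f r <= g r) ->
  g r @[r --> rho%:num^'-] --> l -> (bnorm f <= l%:E)%E.
Proof.
move=> fg gl; apply/lee_addgt0Pr => e e0; rewrite /bnorm limf_esupE -EFinD.
have ge : \forall r \near rho%:num^'-, g r < l + e.
  by apply: (cvgr_lt _ gl); rewrite ltrDl.
apply: (@le_trans _ _ (ereal_sup ((fun r => (gaussF f r)%:E) @`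
    [set r | gaussF f r <= g r /\ g r < l + e]))).
  apply: ereal_inf_lbound; exists [set r | gaussF f r <= g r /\ g r < l + e] => //.
  exact: filterI.
by apply: ge_ereal_sup => _ [r [h1 h2] <-]; rewrite lee_fin (le_trans h1) // ltW.
Qed.

Lemma near_left_gt (a : R) : a < rho%:num ->
  \forall r \near rho%:num^'-, a < r /\ r < rho%:num.
Proof.
by move=> ar; near=> r; split; near: r; [exact: nbhs_left_gt|exact: nbhs_left_lt].
Unshelve. all: by end_near. Qed.

Lemma bnorm_ge0 f : (0 <= bnorm f)%E.
Proof.
rewrite /bnorm limf_esupE; apply: le_ereal_inf_tmp => _ [V FV <-].
have [r [Vr [r0 rrho]]] := filter_ex (filterI FV (near_left_gt (gt0 rho))).
apply: (@le_trans _ _ (gaussF f r)%:E); first by rewrite lee_fin gaussF_ge0.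
by apply: ereal_sup_ubound; exists r.
Qed.

Lemma bnorm_le_mxbnorm m n (A : 'M[{fraction anfun xi rho}]_(m, n)) i j :
  (bnorm (A i j) <= mxbnorm A)%E.
Proof.
apply: le_trans (le_bigmax _ (fun i => \big[maxe/-oo%E]_j bnorm (A i j)) i).
exact: (le_bigmax _ (fun j => bnorm (A i j)) j).
Qed.

End BoundaryNorm.

(** * Passage from radius r to the boundary *)

Theorem mainTheorem1 (R : realType) (p : nat) (K : padicField R p)
    (q : K) (q1 : vabs q = 1)
    (q_nroot1 : forall n : nat, (0 < n)%N -> q ^+ n != 1)
    (q_alg : algebraicOver (@Fp_residue R p K) (vred q))
    (xi : K) (rho : {posnum R}) (qxi : vabs ((q - 1) * xi) < rho%:num)
    (mu : nat) (mu_gt0 : (0 < mu)%N)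
    (Y : 'M[{fraction anfun xi rho}]_mu) (Y_unit : Y \in unitmx) (n : nat) :
  (mxbnorm ((FracField.tofrac (ancst xi rho (qfact q n)))^-1 *: Gmx q1 qxi Y n) <=
   (qbracket q n mu.-1)%:E *
   (\big[maxe/-oo]_(i < mu) (mxbnorm (Gmx q1 qxi Y i) * (rho%:num ^+ i)%:E)) *
   ((rho%:num ^+ n)^-1)%:E)%E.
Proof.
set M := (\big[maxe/-oo]_(i < mu) _)%E; set b := qbracket q n mu.-1.
have rho0 : 0 < rho%:num by [].
have rhon k : 0 < rho%:num ^+ k by rewrite exprn_gt0.
have b1 : 1 <= b by apply: le_trans (qbound_le_qbracket q1 q_nroot1 _ _); apply: qbound_ge1.
have b0 : 0 < b := lt_le_trans ltr01 b1.
have hM (k i j : 'I_mu) : (bnorm (Gmx q1 qxi Y k i j) * (rho%:num ^+ k)%:E <= M)%E.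
  apply: le_trans (le_bigmax _ (fun k : 'I_mu =>
    mxbnorm (Gmx q1 qxi Y k) * (rho%:num ^+ k)%:E)%E k).
  by rewrite lee_wpmul2r ?lee_fin ?(ltW (rhon k)) // bnorm_le_mxbnorm.
(* An index exists because mu > 0; an empty maximum would be -oo. *)
have M0 : (0 <= M)%E.
  by apply: le_trans (hM (Ordinal mu_gt0) (Ordinal mu_gt0) (Ordinal mu_gt0)); 
  rewrite mule_ge0 ?bnorm_ge0 ?lee_fin ?ltW.
apply/bigmax_leP; split=> [|i _]; first exact: leNye.
apply/bigmax_leP; split=> [|j _]; first exact: leNye.
(* [M0] excludes -oo. If [M] is +oo, so is the right-hand side, as b and rho^-n are positive. *)
case: M M0 hM => [m| |] // M0 hM; last first.
  by rewrite gt0_muley ?lte_fin // gt0_mulye ?leey // lte_fin invr_gt0.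
rewrite lee_fin in M0; rewrite -!EFinM.
apply/lee_addgt0Pr => e e0; rewrite -EFinD.
(* Enlarging m by [d] costs exactly e on the right-hand side: b d / rho^n = e. *)
pose d := e * rho%:num ^+ n / b.
have d0 : 0 < d by rewrite divr_gt0 ?mulr_gt0.
have -> : b * m / rho%:num ^+ n + e = b * (m + d) / rho%:num ^+ n.
  rewrite mulrDr mulrDl; congr (_ + _); rewrite /d.
  by field; rewrite ?gt_eqF.
(* Each upper limit lies strictly below its bound enlarged by [d], and finitely many k share a left
   neighbourhood of rho. *)
have hG : \forall r \near rho%:num^'-, forall k : 'I_mu,
    gaussF (Gmx q1 qxi Y k i j) r * rho%:num ^+ k < m + d.
  apply: filter_forall => k.
  have : (bnorm (Gmx q1 qxi Y k i j) < ((m + d) / rho%:num ^+ k)%:E)%E.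
    rewrite EFinM lte_pdivlMr //; apply: le_lt_trans (hM k i j) _.
    by rewrite lte_fin ltrDl.
  move=> /bnorm_lt_near; apply: filterS => r.
  by rewrite lte_fin ltr_pdivlMr.
(* Near rho one has r > |(q - 1) xi|, so the fixed-radius inequality applies, with r^k in its
   hypothesis bounded by rho^k. Then r tends to rho in the majorant. *)
apply: (@bnorm_le_lim _ _ _ _ _ _ (fun r => b * (m + d) / r ^+ n)).
  have := near_left_gt rho0; have := near_left_gt qxi.
  apply: filterS3 hG => r hG [qr _] [r0 rrho].
  have B0 : 0 <= m + d by rewrite addr_ge0 // ltW.
  apply: le_trans (gaussF_Gmx_le (r := r) _ _ _ _ _ B0 _) _ => //; first exact: ltW.
    move=> k; apply: le_trans (ltW (hG k)); rewrite ler_wpM2l ?gaussF_ge0 //.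
    by rewrite lerXn2r ?nnegrE ?ltW.
  rewrite ler_wpM2r ?invr_ge0 ?exprn_ge0 ?(ltW r0) // ler_wpM2r //.
  exact: qbound_le_qbracket.
apply: cvgMr; apply: cvgV; first by rewrite gt_eqF.
apply: cvg_at_left_filter; exact: exprn_continuous.
Qed.
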